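(* Let $k\ge 1$, let $\Lambda$ be a locally convex row-finite $k$-graph and let $K$ be a field. Suppose that $\Lambda$ is strongly aperiodic. Then the following are equivalent: (1) $\mathrm{KP}_K(\Lambda)$ is purely infinite. (2) $\mathrm{KP}_K(\Lambda)$ is properly purely infinite. (3) For each vertex $v\in\Lambda^0$, $s_v$ is a properly infinite idempotent in $\mathrm{KP}_K(\Lambda)$.
   Context: Higher-rank graphs. $\mathbb{N}=\{0,1,2,\dots\}$; $\mathbb{N}^k$ has generators $e_1,\dots,e_k$ and the coordinatewise order. A $k$-graph is a countable small category $\Lambda$ (objects $\Lambda^0$, called vertices and identified with identity morphisms; morphisms called paths; range and source $r,s:\Lambda\to\Lambda^0$; $\lambda\mu$ defined iff $s(\lambda)=r(\mu)$) with a functor $d:\Lambda\to\mathbb{N}^k$ such that for each $\lambda$ and $0\le n\le d(\lambda)$ there is a unique factorisation $\lambda=\lambda(0,n)\lambda(n,d(\lambda))$ with $d(\lambda(0,n))=n$, $d(\lambda(n,d(\lambda)))=d(\lambda)-n$. For $E\subseteq\Lambda$, $H\subseteq\Lambda^0$: $HE=\{\lambda\in E:r(\lambda)\in H\}$, $EH=\{\lambda\in E:s(\lambda)\in H\}$, with $vE$, $Ev$ when $H=\{v\}$. $\Lambda^n=d^{-1}(n)$ and $\Lambda^{\le n}=\{\lambda: d(\lambda)\le n,\text{ and } d(\lambda)+e_i\le n\Rightarrow s(\lambda)\Lambda^{e_i}=\emptyset\}$. $\Lambda$ is row-finite if $v\Lambda^n$ is finite for all $v\in\Lambda^0,n\in\mathbb{N}^k$;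 locally convex if for all $i\ne j$ and $\lambda\in\Lambda^{e_i}$, $r(\lambda)\Lambda^{e_j}\ne\emptyset$ implies $s(\lambda)\Lambda^{e_j}\neq\emptyset$. Boundary paths. For $m\in(\mathbb{N}\cup\{\infty\})^k$, $\Omega_{k,m}=\{(p,q)\in\mathbb{N}^k\times\mathbb{N}^k:p\le q\le m\}$ is the $k$-graph with $d(p,q)=q-p$, $r(p,q)=(p,p)$, $s(p,q)=(q,q)$. A boundary path is a degree-preserving functor $x:\Omega_{k,m}\to\Lambda$ such that $p\in\mathbb{N}^k$, $p\le m$, $p_i=m_i$ imply $x(p,p)\Lambda^{e_i}=\emptyset$; $d(x)=m$, $r(x)=x(0,0)$; $\Lambda^{\le\infty}$ is the set of boundary paths and $v\Lambda^{\le\infty}$ those with range $v$. For $\lambda\in\Lambda$ and $x\in s(\lambda)\Lambda^{\le\infty}$, $\lambda x$ is the concatenated boundary path. $\Lambda$ is aperiodic if for each $v\in\Lambda^0$ there is $x\in v\Lambda^{\le\infty}$ such that $\alpha\ne\beta\in\Lambda v$ implies $\alpha x\ne\beta x$. $H\subseteq\Lambda^0$ is hereditary if $r(\lambda)\in H$ implies $s(\lambda)\in H$; saturated if for all $v\in\Lambda^0$, $n\in\mathbb{N}^k$, $\{s(\lambda):\lambda\in v\Lambda^{\le n}\}\subseteq H$ implies $v\in H$. For $H$ saturated hereditary, $\Lambda\setminus\Lambda H$ is a locally convex row-finite $k$-graph with vertex set $\Lambda^0\setminus H$. $\Lambda$ is strongly aperiodic if $\Lambda\setminus\Lambda H$ is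 aperiodic for every saturated hereditary $H$. Kumjian-Pask algebra. $\mathrm{KP}_K(\Lambda)$ is the universal $K$-algebra generated by $\{s_\lambda,s_{\lambda^*}:\lambda\in\Lambda\}$ (with $s_{v^*}=s_v$ for $v\in\Lambda^0$) subject to: (KP1) $s_vs_w=\delta_{v,w}s_v$ for $v,w\in\Lambda^0$; (KP2) $s_\lambda s_\mu=s_{\lambda\mu}$ and $s_{\mu^*}s_{\lambda^*}=s_{(\lambda\mu)^*}$ if $s(\lambda)=r(\mu)$; (KP3) $s_{\lambda^*}s_\mu=\delta_{\lambda,\mu}s_{s(\lambda)}$ for all $n\in\mathbb{N}^k$ and $\lambda,\mu\in\Lambda^{\le n}$; (KP4) $s_v=\sum_{\lambda\in v\Lambda^{\le n}}s_\lambda s_{\lambda^*}$ for $v\in\Lambda^0$, $n\in\mathbb{N}^k$. Infiniteness in rings. For a (not necessarily unital) ring $R$, $a\in M_m(R)$, $b\in M_n(R)$: $a\oplus b=\mathrm{diag}(a,b)$, and $a\precsim b$ means $a=xby$ for some $x\in M_{m,n}(R)$, $y\in M_{n,m}(R)$. A nonzero $a\in R$ is properly infinite if $a\oplus a\precsim a$. $R$ is purely infinite if (i) no quotient of $R$ is a division ring and (ii) for all $a\in R$, $b\in RaR$ (finite sums of elements $ras'$, $r,s'\in R$) implies $b\precsim a$. $R$ is properly purely infinite if every nonzero element is properly infinite. *)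

(* Defs.v *)
From HB Require Import structures.
From mathcomp Require Import all_boot all_order all_algebra.
From mathcomp Require Import mathcomp_extra boolp classical_sets cardinality.

Set Implicit Arguments.
Unset Strict Implicit.
Unset Printing Implicit Defensive.

Import GRing.Theory.
Local Open Scope classical_set_scope.
Local Open Scope ring_scope.

Notation degree k := {ffun 'I_k -> nat}.

(* [None] is the value infinity. *)
Notation xdegree k := {ffun 'I_k -> option nat}.

Section Degrees.
Variable k : nat.
Implicit Types (p q : degree k) (m : xdegree k).

Definition dbase (i : 'I_k) : degree k := [ffun j => (j == i) : nat].

Definition dle p q : bool := [forall i, (p i <= q i)%N].

Definition dsub p q : degree k := [ffun i => (p i - q i)%N].

Definition xle p m : bool :=
  [forall i, if m i is Some a then (p i <= a)%N else true].

Definition xadd p m : xdegree k := [ffun i => omap (addn (p i)) (m i)].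

Lemma dleP p q : reflect (forall i, (p i <= q i)%N) (dle p q).
Proof. exact: forallP. Qed.

Lemma xleP p m :
  reflect (forall i a, m i = Some a -> (p i <= a)%N) (xle p m).
Proof.
apply: (iffP forallP) => h i; first by move=> a; have := h i; case: (m i) => // b /[swap] -[->].
by case E : (m i) => [a|//]; exact: (h i).
Qed.

Lemma dle_refl p : dle p p.
Proof. by apply/dleP. Qed.

Lemma dle_trans q p t : dle p q -> dle q t -> dle p t.
Proof. by move=> /dleP h /dleP h'; apply/dleP => i; apply: leq_trans (h i) (h' i). Qed.

Lemma dle_xle q p m : dle p q -> xle q m -> xle p m.
Proof.
by move=> /dleP h /xleP h'; apply/xleP => i a /h'; apply: leq_trans (h i).
Qed.

Lemma dsubK p q : dle p q -> p + dsub q p = q.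
Proof. by move=> /dleP h; apply/ffunP => i; rewrite !ffunE; exact: subnKC. Qed.

End Degrees.

(* Vertices form a separate type, identified with the identity morphisms via
   [kid]; countability is carried by [countType]. *)
Record kgraph (k : nat) := KGraph {
  kvert : countType;
  kpath : countType;
  krange : kpath -> kvert;
  ksource : kpath -> kvert;
  kid : kvert -> kpath;
  kcomp : forall l m : kpath, ksource l = krange m -> kpath;
  kdeg : kpath -> degree k;
  krange_id : forall v, krange (kid v) = v;
  ksource_id : forall v, ksource (kid v) = v;
  krange_comp : forall l m (e : ksource l = krange m),
    krange (kcomp e) = krange l;
  ksource_comp : forall l m (e : ksource l = krange m),
    ksource (kcomp e) = ksource m;
  kcomp_idl : forall v l (e : ksource (kid v) = krange l), kcomp e = l;
  kcomp_idr : forall l v (e : ksource l = krange (kid v)), kcomp e = l;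
  kcompA : forall l m n (lm : ksource l = krange m) (mn : ksource m = krange n)
    (lm_n : ksource (kcomp lm) = krange n)
    (l_mn : ksource l = krange (kcomp mn)), kcomp lm_n = kcomp l_mn;
  kdeg_id : forall v, kdeg (kid v) = 0;
  kdeg_comp : forall l m (e : ksource l = krange m),
    kdeg (kcomp e) = kdeg l + kdeg m;
  kfact : forall l (n : degree k), dle n (kdeg l) ->
    exists! ab : kpath * kpath,
      [/\ kdeg ab.1 = n, kdeg ab.2 = dsub (kdeg l) n
        & exists e : ksource ab.1 = krange ab.2, kcomp e = l]
}.

Arguments krange {k} {_} _.
Arguments ksource {k} {_} _.
Arguments kid {k} {_} _.
Arguments kcomp {k} {_} [l m] _.
Arguments kdeg {k} {_} _.

Section KGraphTheory.
Variables (k : nat) (L : kgraph k).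
Implicit Types (l a b c : kpath L) (v w : kvert L) (n p q t : degree k).

(* [vLn v n] is v L^n, [Lle n] is L^{<= n} and [vLle v n] is v L^{<= n}. *)
Definition vLn v n : set (kpath L) :=
  [set l | krange l = v /\ kdeg l = n].

Definition Lle n : set (kpath L) :=
  [set l | dle (kdeg l) n /\
    forall i, dle (kdeg l + dbase i) n -> vLn (ksource l) (dbase i) = set0].

Definition vLle v n : set (kpath L) := [set l | krange l = v /\ Lle n l].

Definition row_finite : Prop := forall v n, finite_set (vLn v n).

Definition locally_convex : Prop :=
  forall (i j : 'I_k) l, i != j -> kdeg l = dbase i ->
    vLn (krange l) (dbase j) !=set0 -> vLn (ksource l) (dbase j) !=set0.

Definition hereditary (H : set (kvert L)) : Prop :=
  forall l, H (krange l) -> H (ksource l).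

Definition saturated (H : set (kvert L)) : Prop :=
  forall v n, ksource @` vLle v n `<=` H -> H v.

(* The unique factorisation (l(0,n), l(n,d(l))), as total functions which are
   meaningful only when n <= d(l). *)
Lemma kfactorP l p : exists ab : kpath L * kpath L, dle p (kdeg l) ->
  [/\ kdeg ab.1 = p, kdeg ab.2 = dsub (kdeg l) p
    & exists e : ksource ab.1 = krange ab.2, kcomp e = l].
Proof.
case h : (dle p (kdeg l)); last by exists (l, l).
by have [ab [hab _]] := kfact h; exists ab.
Qed.

Definition kinit l p : kpath L := (sval (cid (kfactorP l p))).1.
Definition ktail l p : kpath L := (sval (cid (kfactorP l p))).2.

Lemma kinit_tailP l p : dle p (kdeg l) ->
  [/\ kdeg (kinit l p) = p, kdeg (ktail l p) = dsub (kdeg l) p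
    & exists e : ksource (kinit l p) = krange (ktail l p), kcomp e = l].
Proof. exact: (svalP (cid (kfactorP l p))). Qed.

Lemma dle_addr p q : dle p (p + q).
Proof. by apply/dleP => i; rewrite ffunE; exact: leq_addr. Qed.

Lemma dsub_addr p q : dsub (p + q) p = q.
Proof. by apply/ffunP => i; rewrite !ffunE; exact: addKn. Qed.

Lemma kfact_uniq a b (e : ksource a = krange b) :
  kinit (kcomp e) (kdeg a) = a /\ ktail (kcomp e) (kdeg a) = b.
Proof.
have h : dle (kdeg a) (kdeg (kcomp e)) by rewrite kdeg_comp dle_addr.
have [ab [_ hu]] := kfact h.
have [h1 h2 h3] := kinit_tailP h.
have E : ab = (a, b).
  apply: hu; split=> //=; last by exists e.
  by rewrite kdeg_comp dsub_addr.
have : ab = (kinit (kcomp e) (kdeg a), ktail (kcomp e) (kdeg a)).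
  by apply: hu; split.
by rewrite E => -[<- <-].
Qed.

Lemma kcomp_irr a b a' b' (e : ksource a = krange b)
  (e' : ksource a' = krange b') : a = a' -> b = b' -> kcomp e = kcomp e'.
Proof. by move=> ea eb; subst; congr kcomp; exact: eq_irrelevance. Qed.


Lemma kdeg0 l : kdeg l = 0 -> l = kid (krange l).
Proof.
move=> dl0.
have e1 : ksource (kid (krange l)) = krange l by rewrite ksource_id.
have e2 : ksource l = krange (kid (ksource l)) by rewrite krange_id.
have [+ _] := kfact_uniq e1; have [+ _] := kfact_uniq e2.
by rewrite kcomp_idl kcomp_idr kdeg_id dl0 => -> .
Qed.

Lemma kcomp_deg a b c (e : ksource a = krange b) (h : c = kcomp e) :
  kinit c (kdeg a) = a /\ ktail c (kdeg a) = b.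
Proof. by rewrite h; exact: kfact_uniq. Qed.

Lemma kinit_comp a b p (e : ksource a = krange b) :
  dle p (kdeg a) -> kinit (kcomp e) p = kinit a p.
Proof.
move=> h; have [h1 h2 [e1 E]] := kinit_tailP h.
have e2 : ksource (ktail a p) = krange b by rewrite -e -{2}E ksource_comp.
have e3 : ksource (kinit a p) = krange (kcomp e2) by rewrite e1 krange_comp.
have e4 : ksource (kcomp e1) = krange b by rewrite ksource_comp.
have E3 : kcomp e = kcomp e3 by rewrite -(kcompA e4 e3); exact: kcomp_irr.
by have [+ _] := kcomp_deg E3; rewrite h1.
Qed.

Lemma kinit_kinit c p q : dle p q -> dle q (kdeg c) ->
  kinit (kinit c q) p = kinit c p.
Proof.
move=> pq qc; have [dq _ [e' E]] := kinit_tailP qc.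
by rewrite -{2}E kinit_comp ?dq.
Qed.

Lemma ktail0 l : ktail l 0 = l.
Proof.
have e : ksource (kid (krange l)) = krange l by rewrite ksource_id.
by have [_] := kfact_uniq e; rewrite kcomp_idl kdeg_id.
Qed.

Lemma dbase_le i p : (0 < p i)%N -> dle (dbase i) p.
Proof.
by move=> pi; apply/dleP => j; rewrite ffunE; case: eqP => // ->.
Qed.

Lemma locally_convex_path : locally_convex -> forall (i : 'I_k) l,
  kdeg l i = 0%N -> vLn (krange l) (dbase i) !=set0 ->
  vLn (ksource l) (dbase i) !=set0.
Proof.
move=> lc i l; have [N] := ubnP (\sum_j kdeg l j)%N.
elim: N l => // N IH l lN li.
have [/forallP l0|] := boolP [forall j, kdeg l j == 0%N].
  have -> : l = kid (krange l).
    by apply: kdeg0; apply/ffunP => j; rewrite ffunE; exact/eqP.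
  by rewrite krange_id ksource_id.
rewrite negb_forall => /existsP[j]; rewrite -lt0n => lj.
have ji : j != i by apply: contraTneq lj => ->; rewrite li.
have [d1 d2 [e E]] := kinit_tailP (dbase_le lj).
rewrite -{1}E krange_comp => /(lc _ _ _ ji d1); rewrite e -{2}E ksource_comp.
apply: IH; last by rewrite d2 ffunE li.
rewrite d2; move: lN; rewrite ltnS; apply: leq_trans.
rewrite (bigD1 j) //= [X in (_ < X)%N](bigD1 j) //=.
rewrite -addSn leq_add //; last by apply: leq_sum => a _; rewrite ffunE leq_subr.
by rewrite !ffunE eqxx subn1 prednK.
Qed.

Lemma kinit_id l : kinit l (kdeg l) = l.
Proof.
have e : ksource l = krange (kid (ksource l)) by rewrite krange_id.
by have [+ _] := kfact_uniq e; rewrite kcomp_idr.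
Qed.

End KGraphTheory.

Record kmorphism (k : nat) (L M : kgraph k) := KMorphism {
  mvert : kvert L -> kvert M;
  mpath :> kpath L -> kpath M;
  mrange : forall l, krange (mpath l) = mvert (krange l);
  msource : forall l, ksource (mpath l) = mvert (ksource l);
  mid : forall v, mpath (kid v) = kid (mvert v);
  mcomp : forall l m (e : ksource l = krange m)
    (e' : ksource (mpath l) = krange (mpath m)),
    mpath (kcomp e) = kcomp e';
  mdeg : forall l, kdeg (mpath l) = kdeg l
}.

Lemma kmorphism_eq (k : nat) (L M : kgraph k) (f g : kmorphism L M) :
  mpath f =1 mpath g -> f = g.
Proof.
move=> fg; have vfg : mvert f = mvert g.
  by apply: funext => v; rewrite -[v]krange_id -!mrange fg.
have {}fg : mpath f = mpath g by exact: funext.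
case: f g vfg fg => f0 f1 a1 a2 a3 a4 a5 [g0 g1 b1 b2 b3 b4 b5] /= h0 h1.
by subst g0 g1; congr KMorphism; exact: Prop_irrelevance.
Qed.

Section Omega.
Variables (k : nat) (m : xdegree k).

Definition om_vert : countType := {p : degree k | xle p m}.
Definition om_path : countType :=
  {pq : degree k * degree k | dle pq.1 pq.2 && xle pq.2 m}.

Lemma om_range_subproof (l : om_path) : xle (val l).1 m.
Proof. by case/andP: (valP l) => h; exact: dle_xle. Qed.
Lemma om_source_subproof (l : om_path) : xle (val l).2 m.
Proof. by case/andP: (valP l). Qed.

Definition om_range (l : om_path) : om_vert :=
  exist _ (val l).1 (om_range_subproof l).
Definition om_source (l : om_path) : om_vert :=
  exist _ (val l).2 (om_source_subproof l).

Lemma om_id_subproof (v : om_vert) : dle (val v) (val v) && xle (val v) m.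
Proof. by rewrite dle_refl (valP v). Qed.
Definition om_id (v : om_vert) : om_path :=
  exist _ (val v, val v) (om_id_subproof v).

Lemma om_comp_subproof (l n : om_path) (e : om_source l = om_range n) :
  dle (val l).1 (val n).2 && xle (val n).2 m.
Proof.
case/andP: (valP n) => n12 ->; case/andP: (valP l) => l12 _; rewrite andbT.
by move/(congr1 val): e => /= e; apply: dle_trans n12; rewrite -e.
Qed.
Definition om_comp (l n : om_path) (e : om_source l = om_range n) : om_path :=
  exist _ ((val l).1, (val n).2) (om_comp_subproof e).

Definition om_deg (l : om_path) : degree k := dsub (val l).2 (val l).1.

Lemma om_comp_idl v l (e : om_source (om_id v) = om_range l) : om_comp e = l.
Proof.
by apply: val_inj => /=; move/(congr1 val): e => /= ->; case: (val l).
Qed.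
Lemma om_comp_idr l v (e : om_source l = om_range (om_id v)) : om_comp e = l.
Proof.
by apply: val_inj => /=; move/(congr1 val): e => /= <-; case: (val l).
Qed.
Lemma om_deg_id v : om_deg (om_id v) = 0.
Proof. by apply/ffunP => i; rewrite !ffunE subnn. Qed.
Lemma om_deg_comp l n (e : om_source l = om_range n) :
  om_deg (om_comp e) = om_deg l + om_deg n.
Proof.
apply/ffunP => i; rewrite !ffunE /=; have {}e := congr1 val e; simpl in e.
case/andP: (valP n) => /dleP/(_ i) n12 _.
case/andP: (valP l) => /dleP/(_ i) l12 _.
rewrite e in l12 *; rewrite [RHS]addnC addnBA // subnK //.
Qed.
Lemma om_fact l (n : degree k) : dle n (om_deg l) ->
  exists! ab : om_path * om_path,
    [/\ om_deg ab.1 = n, om_deg ab.2 = dsub (om_deg l) n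
      & exists e : om_source ab.1 = om_range ab.2, om_comp e = l].
Proof.
case: l => -[p q] /= h /dleP nl; have := h => /= /andP[/dleP pq qm].
have n_q i : (p i + n i <= q i)%N.
  by have := nl i; rewrite ffunE /= leq_subRL // addnC.
have ha : dle p (p + n) && xle (p + n) m.
  apply/andP; split; first by apply/dleP => i; rewrite ffunE leq_addr.
  by apply: dle_xle qm; apply/dleP => i; rewrite ffunE.
have hb : dle (p + n) q && xle q m.
  by rewrite qm andbT; apply/dleP => i; rewrite ffunE.
exists (exist _ (p, p + n) ha, exist _ (p + n, q) hb); split.
  split=> /=.
  - by apply/ffunP => i; rewrite !ffunE /= addKn.
  - by apply/ffunP => i; rewrite !ffunE /= subnDA.
  - have e : om_source (exist _ (p, p + n) ha)
      = om_range (exist _ (p + n, q) hb) by exact: val_inj.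
    by exists e; exact: val_inj.
case=> -[[a1 a2] ha'] [[b1 b2] hb'] /= [da db [e E]].
have {E} [? ?] : (a1, b2) = (p, q) := congr1 val E.
have {}e : a2 = b1 := congr1 val e; subst.
have E : p + dsub b1 p = b1 by apply: dsubK; have /andP[] := ha'.
by congr (_, _); apply: val_inj; congr (_, _); exact: E.
Qed.

Lemma om_range_id v : om_range (om_id v) = v.
Proof. exact: val_inj. Qed.
Lemma om_source_id v : om_source (om_id v) = v.
Proof. exact: val_inj. Qed.
Lemma om_range_comp l n (e : om_source l = om_range n) :
  om_range (om_comp e) = om_range l.
Proof. exact: val_inj. Qed.
Lemma om_source_comp l n (e : om_source l = om_range n) :
  om_source (om_comp e) = om_source n.
Proof. exact: val_inj. Qed.
Lemma om_compA l n t (ln : om_source l = om_range n)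
  (nt : om_source n = om_range t) (ln_t : om_source (om_comp ln) = om_range t)
  (l_nt : om_source l = om_range (om_comp nt)) : om_comp ln_t = om_comp l_nt.
Proof. exact: val_inj. Qed.

Definition Omega : kgraph k := @KGraph k om_vert om_path om_range om_source
  om_id om_comp om_deg om_range_id om_source_id om_range_comp om_source_comp
  om_comp_idl om_comp_idr om_compA om_deg_id om_deg_comp om_fact.

Definition omv (p : degree k) (h : xle p m) : kvert Omega := exist _ p h.

Lemma omp_subproof p q : dle p q -> xle q m -> dle p q && xle q m.
Proof. by move=> -> ->. Qed.

Definition omp (p q : degree k) (pq : dle p q) (qm : xle q m) : kpath Omega :=
  exist _ (p, q) (omp_subproof pq qm).

Lemma dle0 (p : degree k) : dle 0 p.
Proof. by apply/dleP => i; rewrite ffunE. Qed.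

Lemma xle0 : xle 0 m.
Proof. by apply/xleP => i a; rewrite ffunE. Qed.

End Omega.

(* A degree-preserving functor on some Omega_{k,m}, with m = [ideg]; boundary
   paths are the ones satisfying [is_boundary]. *)
Record ipath (k : nat) (L : kgraph k) := IPath {
  ideg : xdegree k;
  ifun :> kmorphism (Omega ideg) L
}.

Section BoundaryPaths.
Variables (k : nat) (L : kgraph k).

Lemma ipath_eq (x y : ipath L) : ideg x = ideg y ->
  (forall p q (pq : dle p q) (qx : xle q (ideg x)) (qy : xle q (ideg y)),
    x (omp pq qx) = y (omp pq qy)) -> x = y.
Proof.
case: x y => m x [m' y] /= mm'; subst m' => xy; congr IPath.
apply: kmorphism_eq => -[[p q] h]; have /andP[/= pq qm] := h.
have -> : exist _ (p, q) h = omp pq qm :> om_path m by exact: val_inj.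
exact: xy.
Qed.

Definition irange (x : ipath L) : kvert L := mvert x (omv (xle0 (ideg x))).

Definition is_boundary (x : ipath L) : Prop :=
  forall (p : degree k) (hp : xle p (ideg x)) (i : 'I_k),
    ideg x i = Some (p i) -> vLn (mvert x (omv hp)) (dbase i) = set0.

(* A functor on Omega_{k,m} from its initial segments Y q = x(0,q). *)
Section Coherent.
Variables (m : xdegree k) (Y : forall q, xle q m -> kpath L).
Hypothesis Ydeg : forall q (hq : xle q m), kdeg (Y hq) = q.
Hypothesis Yinit : forall p q (hp : xle p m) (hq : xle q m), dle p q ->
  kinit (Y hq) p = Y hp.

Definition coh_vert (v : kvert (Omega m)) : kvert L := ksource (Y (valP v)).
Definition coh_path (l : kpath (Omega m)) : kpath L :=
  ktail (Y (om_source_subproof l)) (val l).1.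

Lemma coh_split p q (hp : xle p m) (hq : xle q m) : dle p q ->
  kdeg (ktail (Y hq) p) = dsub q p /\
  exists e : ksource (Y hp) = krange (ktail (Y hq) p), kcomp e = Y hq.
Proof.
move=> pq; have h : dle p (kdeg (Y hq)) by rewrite Ydeg.
by have [_] := kinit_tailP h; rewrite (Yinit hp hq pq) Ydeg => -> ?; split.
Qed.

Lemma Yirr p q (hp : xle p m) (hq : xle q m) : p = q -> Y hp = Y hq.
Proof. by move=> pq; subst; congr Y; exact: bool_irrelevance. Qed.

Lemma coh_pathP (l : kpath (Omega m)) : kdeg (coh_path l) = kdeg l /\
  exists e : ksource (Y (valP (krange l))) = krange (coh_path l),
    kcomp e = Y (valP (ksource l)).
Proof.
have /andP[pq _] := valP l.
have [h1 [e E]] := coh_split (valP (krange l)) (om_source_subproof l) pq.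
by split=> //; exists e; rewrite E; exact: Yirr.
Qed.

Lemma coh_range l : krange (coh_path l) = coh_vert (krange l).
Proof. by have [_ [e _]] := coh_pathP l; rewrite -e. Qed.

Lemma coh_source l : ksource (coh_path l) = coh_vert (ksource l).
Proof. by have [_ [e E]] := coh_pathP l; rewrite /coh_vert -E ksource_comp. Qed.

Lemma coh_deg l : kdeg (coh_path l) = kdeg l.
Proof. by have [] := coh_pathP l. Qed.

Lemma coh_id v : coh_path (kid v) = kid (coh_vert v).
Proof.
by rewrite [LHS]kdeg0 ?coh_deg ?kdeg_id // coh_range krange_id.
Qed.

Lemma coh_comp l n (e : ksource l = krange n)
  (e' : ksource (coh_path l) = krange (coh_path n)) :
  coh_path (kcomp e) = kcomp e'.
Proof.
have [_ [e1 E1]] := coh_pathP l.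
have [_ [e2 E2]] := coh_pathP n.
have [_ [e3 E3]] := coh_pathP (kcomp e).
have e4 : ksource (kcomp e1) = krange (coh_path n) by rewrite ksource_comp.
have e5 : ksource (Y (valP (krange l))) = krange (kcomp e')
  by rewrite krange_comp.
have E4 : kcomp e4 = Y (valP (ksource (kcomp e))).
  transitivity (Y (valP (ksource n))); last first.
    by apply: Yirr; exact: (congr1 val (esym (ksource_comp e))).
  rewrite -E2; apply: kcomp_irr => //; rewrite E1.
  by apply: Yirr; exact: (congr1 val e).
have [h1 h2] := kcomp_deg (esym E3).
have [h3 h4] := kcomp_deg (etrans (esym E4) (kcompA e4 e5)).
rewrite -h2 -h4; congr ktail; rewrite !Ydeg.
exact: (congr1 val (krange_comp e)).
Qed.

Definition coh_morphism : kmorphism (Omega m) L :=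
  KMorphism coh_range coh_source coh_id coh_comp coh_deg.

End Coherent.

(* The concatenation l x, i.e. the path with (l x)(p,q) = (l x(0,t))(p,q) for
   any t with q <= d(l) + t; here t = q - d(l). It is again a boundary path
   when x is one and L is locally convex. *)
Section Concat.
Variables (l : kpath L) (x : ipath L) (e : ksource l = irange x).

Lemma concat_bound q : xle q (xadd (kdeg l) (ideg x)) ->
  xle (dsub q (kdeg l)) (ideg x).
Proof.
move=> /xleP h; apply/xleP => i a xa; rewrite ffunE leq_subLR.
by apply: h; rewrite ffunE xa.
Qed.

Lemma concat_comp t (h : xle t (ideg x)) :
  ksource l = krange (x (omp (dle0 t) h)).
Proof. by rewrite e mrange; congr (mvert x); exact: val_inj. Qed.

Definition concat_init q (h : xle q (xadd (kdeg l) (ideg x))) : kpath L :=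
  kinit (kcomp (concat_comp (concat_bound h))) q.

Lemma dle_concat q : dle q (kdeg l + dsub q (kdeg l)).
Proof. by apply/dleP => i; rewrite !ffunE -leq_subLR. Qed.

Lemma concat_deg0 t (h : xle t (ideg x)) : kdeg (kcomp (concat_comp h)) = kdeg l + t.
Proof.
by rewrite kdeg_comp mdeg; congr (_ + _); apply/ffunP => i; rewrite !ffunE subn0.
Qed.

Lemma concat_deg q (h : xle q (xadd (kdeg l) (ideg x))) :
  kdeg (concat_init h) = q.
Proof.
have hq : dle q (kdeg (kcomp (concat_comp (concat_bound h)))).
  by rewrite concat_deg0 dle_concat.
by have [] := kinit_tailP hq.
Qed.

Lemma concat_grow t t' (h : xle t (ideg x)) (h' : xle t' (ideg x)) q :
  dle t t' -> dle q (kdeg l + t) ->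
  kinit (kcomp (concat_comp h')) q = kinit (kcomp (concat_comp h)) q.
Proof.
move=> tt' hq.
have oe : @ksource k (Omega (ideg x)) (omp (dle0 t) h) = krange (omp tt' h').
  exact: val_inj.
have xe : ksource (x (omp (dle0 t) h)) = krange (x (omp tt' h')).
  by rewrite msource mrange oe.
have E : x (omp (dle0 t') h') = kcomp xe.
  by rewrite -(mcomp oe); congr (mpath x); exact: val_inj.
have e1 : ksource (kcomp (concat_comp h)) = krange (x (omp tt' h')).
  by rewrite ksource_comp.
have e2 : ksource l = krange (kcomp xe) by rewrite -E; exact: concat_comp.
rewrite -(kinit_comp e1) ?concat_deg0 // (kcompA e1 e2).
by congr kinit; exact: kcomp_irr.
Qed.

Lemma concat_coh p q (hp : xle p (xadd (kdeg l) (ideg x)))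
    (hq : xle q (xadd (kdeg l) (ideg x))) : dle p q ->
  kinit (concat_init hq) p = concat_init hp.
Proof.
move=> pq; rewrite kinit_kinit ?concat_deg0 ?dle_concat //.
apply: concat_grow; last exact: dle_concat.
by apply/dleP => i; rewrite !ffunE leq_sub2r //; move/dleP: pq.
Qed.

Definition concat : ipath L := IPath (coh_morphism concat_deg concat_coh).

Lemma concat_head (h : xle (kdeg l) (ideg concat)) :
  concat (omp (dle0 (kdeg l)) h) = l.
Proof.
rewrite /= /coh_path /= ktail0 /concat_init kinit_comp ?dle_refl //.
exact: kinit_id.
Qed.

Lemma concat_tail p q (pq : dle p q) (qx : xle q (ideg x))
    (pq' : dle (kdeg l + p) (kdeg l + q)) (h : xle (kdeg l + q) (ideg concat)) :
  concat (omp pq' h) = x (omp pq qx).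
Proof.
rewrite /= /coh_path /= /concat_init.
set E := concat_comp _; set c := kcomp E.
have dc : kdeg c = kdeg l + q by rewrite /c concat_deg0 dsub_addr.
rewrite -dc kinit_id /c {c dc} /=.
have px : xle p (ideg x) by exact: dle_xle qx.
have oe : @ksource k (Omega (ideg x)) (omp (dle0 p) px) = krange (omp pq qx).
  exact: val_inj.
have xe : ksource (x (omp (dle0 p) px)) = krange (x (omp pq qx)).
  by rewrite msource mrange oe.
have xE : x (omp (dle0 q) qx) = kcomp xe.
  by rewrite -(mcomp oe); congr (mpath x); exact: val_inj.
have e1 : ksource (kcomp (concat_comp px)) = krange (x (omp pq qx)).
  by rewrite ksource_comp.
have e2 : ksource l = krange (kcomp xe) by rewrite -xE; exact: concat_comp.
have EE : kcomp E = kcomp e1.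
  rewrite (kcompA e1 e2); apply: kcomp_irr => //; rewrite -xE.
  by congr (mpath x); apply: val_inj; rewrite /= dsub_addr.
have [_ h2] := kfact_uniq e1.
by rewrite -[RHS]h2 EE; congr ktail; rewrite concat_deg0.
Qed.

Lemma concat_boundary : locally_convex L -> is_boundary x -> is_boundary concat.
Proof.
move=> lc bx p hp i; rewrite ffunE => mi.
pose t' : degree k := dsub p (kdeg l); pose t := kdeg l + t'.
have ht' : xle t' (ideg x) by exact: concat_bound.
have ht : xle t (ideg concat).
  apply/xleP => j a; rewrite !ffunE; case E : (ideg x j) => [b|//] [<-].
  by rewrite leq_add2l; move/xleP: ht' => /(_ _ _ E); rewrite ffunE.
have pt : dle p t by exact: dle_concat.
case Ei : (ideg x i) mi => [b|//] /= [pi].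
have xt0 : vLn (mvert x (omv ht')) (dbase i) = set0.
  by apply: bx; rewrite Ei ffunE -pi addKn.
have vE : mvert x (omv ht') = mvert concat (omv ht).
  have qq : dle t t by exact: dle_refl.
  have := concat_tail (dle_refl t') ht' qq ht; rewrite -/t.
  move/(congr1 krange); rewrite !mrange => /esym.
  have -> : krange (omp (dle_refl t') ht') = omv ht' by exact: val_inj.
  by have -> : krange (omp qq ht) = omv ht by exact: val_inj.
apply/eqP/negPn/negP => /set0P ne; suff : vLn (mvert x (omv ht')) (dbase i) !=set0.
  by rewrite xt0 => -[].
rewrite vE.
have <- : ksource (concat (omp pt ht)) = mvert concat (omv ht).
  by rewrite msource; congr (mvert concat); exact: val_inj.
apply: locally_convex_path => //; last first.
  rewrite mrange; have -> // : krange (omp pt ht) = omv hp by exact: val_inj.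
by rewrite mdeg /= /om_deg !ffunE /= -pi addKn subnn.
Qed.

End Concat.

(* Here L v is the set of paths with source v. The concatenations are compared
   as functors; by [concat_boundary] they are boundary paths when L is locally
   convex. *)
Definition aperiodic : Prop :=
  forall v : kvert L, exists x : ipath L, is_boundary x /\
    exists xv : irange x = v,
      forall (a b : kpath L) (av : ksource a = v) (bv : ksource b = v),
        a <> b ->
        concat (etrans av (esym xv)) <> concat (etrans bv (esym xv)).

End BoundaryPaths.

(* The k-graph L \ L H, on the paths whose source is not in H. *)
Section Minus.
Variables (k : nat) (L : kgraph k) (H : set (kvert L)) (hH : hereditary H).

Definition mi_vert : countType := {v : kvert L | v \notin H}.
Definition mi_path : countType := {l : kpath L | ksource l \notin H}.

Lemma mi_range_subproof (l : mi_path) : krange (val l) \notin H.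
Proof. by apply: contra (valP l) => /set_mem/hH/mem_set. Qed.

Definition mi_range (l : mi_path) : mi_vert :=
  exist _ (krange (val l)) (mi_range_subproof l).
Definition mi_source (l : mi_path) : mi_vert :=
  exist _ (ksource (val l)) (valP l).

Lemma mi_id_subproof (v : mi_vert) : ksource (kid (val v)) \notin H.
Proof. by rewrite ksource_id (valP v). Qed.
Definition mi_id (v : mi_vert) : mi_path :=
  exist _ (kid (val v)) (mi_id_subproof v).

Lemma mi_comp_subproof (l n : mi_path) (e : ksource (val l) = krange (val n)) :
  ksource (kcomp e) \notin H.
Proof. by rewrite ksource_comp (valP n). Qed.
Definition mi_comp (l n : mi_path) (e : mi_source l = mi_range n) : mi_path :=
  exist _ (kcomp (congr1 val e)) (mi_comp_subproof (congr1 val e)).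

Definition mi_deg (l : mi_path) : degree k := kdeg (val l).

Lemma mi_range_id v : mi_range (mi_id v) = v.
Proof. by apply: val_inj; exact: krange_id. Qed.
Lemma mi_source_id v : mi_source (mi_id v) = v.
Proof. by apply: val_inj; exact: ksource_id. Qed.
Lemma mi_range_comp l n (e : mi_source l = mi_range n) :
  mi_range (mi_comp e) = mi_range l.
Proof. by apply: val_inj; exact: krange_comp. Qed.
Lemma mi_source_comp l n (e : mi_source l = mi_range n) :
  mi_source (mi_comp e) = mi_source n.
Proof. by apply: val_inj; exact: ksource_comp. Qed.
Lemma mi_comp_idl v l (e : mi_source (mi_id v) = mi_range l) : mi_comp e = l.
Proof. by apply: val_inj; exact: kcomp_idl. Qed.
Lemma mi_comp_idr l v (e : mi_source l = mi_range (mi_id v)) : mi_comp e = l.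
Proof. by apply: val_inj; exact: kcomp_idr. Qed.
Lemma mi_compA l n t (ln : mi_source l = mi_range n)
  (nt : mi_source n = mi_range t) (ln_t : mi_source (mi_comp ln) = mi_range t)
  (l_nt : mi_source l = mi_range (mi_comp nt)) : mi_comp ln_t = mi_comp l_nt.
Proof. by apply: val_inj; exact: kcompA. Qed.
Lemma mi_deg_id v : mi_deg (mi_id v) = 0.
Proof. exact: kdeg_id. Qed.
Lemma mi_deg_comp l n (e : mi_source l = mi_range n) :
  mi_deg (mi_comp e) = mi_deg l + mi_deg n.
Proof. exact: kdeg_comp. Qed.
Lemma mi_fact l (n : degree k) : dle n (mi_deg l) ->
  exists! ab : mi_path * mi_path,
    [/\ mi_deg ab.1 = n, mi_deg ab.2 = dsub (mi_deg l) n
      & exists e : mi_source ab.1 = mi_range ab.2, mi_comp e = l].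
Proof.
move=> /kfact[[a b] /= [[da db [e E]] u]].
have hb : ksource b \notin H by rewrite -(ksource_comp e) E (valP l).
have ha : ksource a \notin H by rewrite e (mi_range_subproof (exist _ b hb)).
exists (exist _ a ha, exist _ b hb); split.
  split=> //=.
  have e' : mi_source (exist _ a ha) = mi_range (exist _ b hb) by exact: val_inj.
  exists e'; apply: val_inj; apply: etrans E; exact: kcomp_irr.
case=> [a' b'] /= [da' db' [e' E']].
have [? ?] : (a, b) = (val a', val b').
  by apply: u; split=> //=; exists (congr1 val e'); exact: (congr1 val E').
by congr (_, _); exact: val_inj.
Qed.

Definition kminus : kgraph k := @KGraph k mi_vert mi_path mi_range mi_source
  mi_id mi_comp mi_deg mi_range_id mi_source_id mi_range_comp mi_source_comp
  mi_comp_idl mi_comp_idr mi_compA mi_deg_id mi_deg_comp mi_fact.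

End Minus.

Definition strongly_aperiodic (k : nat) (L : kgraph k) : Prop :=
  forall (H : set (kvert L)) (hH : hereditary H), saturated H ->
    aperiodic (kminus hH).

HB.mixin Record isNuRing R of GRing.Zmodule R := {
  nmul : R -> R -> R;
  nmulA : associative nmul;
  nmulDl : left_distributive nmul +%R;
  nmulDr : right_distributive nmul +%R
}.

#[short(type="nuRingType")]
HB.structure Definition NuRing := {R of isNuRing R & GRing.Zmodule R}.

Notation "x ** y" := (nmul x y) (at level 40, left associativity) : ring_scope.

HB.mixin Record isNuAlgebra (K : pzRingType) A
    of GRing.Lmodule K A & NuRing A := {
  nscaleAl : forall (c : K) (x y : A), c *: (x ** y) = (c *: x) ** y;
  nscaleAr : forall (c : K) (x y : A), c *: (x ** y) = x ** (c *: y)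
}.

#[short(type="nuAlgType")]
HB.structure Definition NuAlgebra (K : pzRingType) :=
  {A of isNuAlgebra K A & GRing.Lmodule K A & NuRing A}.

HB.mixin Record isNuIdeal (R : nuRingType) (I : {pred R}) := {
  nuideal_closed : forall x y : R, y \in I -> (x ** y \in I) && (y ** x \in I)
}.

(* Two-sided ideals are boolean predicates, as in the library; by [asbool] every
   [set R] is one. *)
#[short(type="nuIdeal")]
HB.structure Definition NuIdeal (R : nuRingType) :=
  {I of GRing.ZmodClosed R I & isNuIdeal R I}.

Section NuRingTheory.
Variable R : nuRingType.
Implicit Types x y : R.

Lemma nmul0l x : 0 ** x = 0.
Proof. by apply: (addrI (0 ** x)); rewrite -nmulDl !addr0. Qed.
Lemma nmul0r x : x ** 0 = 0.
Proof. by apply: (addrI (x ** 0)); rewrite -nmulDr !addr0. Qed.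
Lemma nmulNl x y : (- x) ** y = - (x ** y).
Proof. by apply/eqP; rewrite -addr_eq0 -nmulDl addNr nmul0l. Qed.
Lemma nmulNr x y : x ** (- y) = - (x ** y).
Proof. by apply/eqP; rewrite -addr_eq0 -nmulDr addNr nmul0r. Qed.

End NuRingTheory.

(* The quotient ring R/I, on the library's quotient additive group. *)
Section NuQuotient.
Variables (R : nuRingType) (I : nuIdeal R).
Local Open Scope quotient_scope.

Lemma nuidealMl (x y : R) : y \in I -> x ** y \in I.
Proof. by move=> /(nuideal_closed x)/andP[]. Qed.
Lemma nuidealMr (x y : R) : y \in I -> y ** x \in I.
Proof. by move=> /(nuideal_closed x)/andP[]. Qed.

Definition nuquot : Type := Quotient.quot I.
HB.instance Definition _ := Choice.on nuquot.
HB.instance Definition _ := EqQuotient.on nuquot.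
HB.instance Definition _ := GRing.Zmodule.on nuquot.

Definition nuquot_mul (x y : nuquot) : nuquot := \pi_nuquot (repr x ** repr y).

Definition nuproj (x : R) : nuquot := \pi_nuquot x.

Lemma nuproj_surj (z : nuquot) : exists x, nuproj x = z.
Proof. by exists (repr z); exact: reprK. Qed.

Lemma nuprojE (x y : R) : nuproj x = nuproj y <-> x - y \in I.
Proof. by rewrite (Quotient.idealrBE I x y); split=> [/eqP|/eqP]. Qed.

Lemma nuprojM (x y : R) : nuquot_mul (nuproj x) (nuproj y) = nuproj (x ** y).
Proof.
apply/nuprojE; set x' := repr _; set y' := repr _.
have hx : x' - x \in I by apply/nuprojE; exact: reprK.
have hy : y' - y \in I by apply/nuprojE; exact: reprK.
have -> : x' ** y' - x ** y = (x' - x) ** y' + x ** (y' - y).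
  by rewrite nmulDl nmulDr nmulNl nmulNr addrA subrK.
by apply: rpredD; [exact: nuidealMr | exact: nuidealMl].
Qed.

Lemma nuprojD (x y : R) : nuproj x + nuproj y = nuproj (x + y).
Proof. exact/esym/Quotient.pi_add. Qed.

Lemma nuquot_mulA : associative nuquot_mul.
Proof.
move=> a b c; have [x <-] := nuproj_surj a.
have [y <-] := nuproj_surj b; have [z <-] := nuproj_surj c.
by rewrite (nuprojM y z) (nuprojM x y) (nuprojM x) (nuprojM _ z) nmulA.
Qed.

Lemma nuquot_mulDl : left_distributive nuquot_mul +%R.
Proof.
move=> a b c; have [x <-] := nuproj_surj a.
have [y <-] := nuproj_surj b; have [z <-] := nuproj_surj c.
by rewrite (nuprojD x y) (nuprojM x z) (nuprojM y z) (nuprojM _ z) nmulDl nuprojD.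
Qed.

Lemma nuquot_mulDr : right_distributive nuquot_mul +%R.
Proof.
move=> a b c; have [x <-] := nuproj_surj a.
have [y <-] := nuproj_surj b; have [z <-] := nuproj_surj c.
by rewrite (nuprojD y z) (nuprojM x y) (nuprojM x z) (nuprojM x) nmulDr nuprojD.
Qed.

HB.instance Definition _ :=
  isNuRing.Build nuquot nuquot_mulA nuquot_mulDl nuquot_mulDr.

End NuQuotient.

Definition is_division_ring (R : nuRingType) : Prop :=
  exists e : R, [/\ e != 0,
    (forall x, e ** x = x /\ x ** e = x)
    & forall x, x != 0 -> exists y, x ** y = e /\ y ** x = e].

Section Infinite.
Variable R : nuRingType.

Definition numulmx (m n p : nat) (A : 'M[R]_(m, n)) (B : 'M[R]_(n, p)) :
  'M[R]_(m, p) := \matrix_(i, j) \sum_l A i l ** B l j.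

Definition mxoplus (m n : nat) (a : 'M[R]_m) (b : 'M[R]_n) : 'M[R]_(m + n) :=
  block_mx a 0 0 b.

Definition precsim (m n : nat) (a : 'M[R]_m) (b : 'M[R]_n) : Prop :=
  exists (x : 'M[R]_(m, n)) (y : 'M[R]_(n, m)), a = numulmx (numulmx x b) y.

(* R viewed as M_1(R). *)
Definition mx1 (a : R) : 'M[R]_1 := const_mx a.

Definition properly_infinite (a : R) : Prop :=
  a <> 0 /\ precsim (mxoplus (mx1 a) (mx1 a)) (mx1 a).

(* The set RaR of finite sums of elements r a s. *)
Definition in_RaR (a b : R) : Prop :=
  exists (n : nat) (r s : 'I_n -> R), b = \sum_(i < n) r i ** a ** s i.

Definition purely_infinite : Prop :=
  (forall I : nuIdeal R, ~ is_division_ring (nuquot I)) /\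
  (forall a b : R, in_RaR a b -> precsim (mx1 b) (mx1 a)).

Definition properly_purely_infinite : Prop :=
  forall a : R, a <> 0 -> properly_infinite a.

Definition nu_idempotent (a : R) : Prop := a ** a = a.

End Infinite.

Section KumjianPask.
Variables (K : fieldType) (k : nat) (L : kgraph k).

(* The Kumjian-Pask relations for S = (s_l) and T = (s_{l^*}) in an algebra.
   In (KP4) the finite set v L^{<= n} is enumerated by a duplicate-free list;
   the order of summation is irrelevant. *)
Definition KP_family (A : nuAlgType K) (S T : kpath L -> A) : Prop :=
  [/\ forall v, T (kid v) = S (kid v),
      forall v w : kvert L,
        S (kid v) ** S (kid w) = if v == w then S (kid v) else 0,
      forall l m (e : ksource l = krange m),
        S l ** S m = S (kcomp e) /\ T m ** T l = T (kcomp e),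
      forall (n : degree k) l m, Lle n l -> Lle n m ->
        T l ** S m = if l == m then S (kid (ksource l)) else 0
    & forall v (n : degree k) (E : seq (kpath L)),
        uniq E -> (forall l, l \in E <-> vLle v n l) ->
        S (kid v) = \sum_(l <- E) S l ** T l].

(* KP_K(L) is the quotient of the type of formal expressions in the generators
   by the congruence generated by the axioms of K-algebras and (KP1)-(KP4). *)
Inductive kpterm : Type :=
  | KPgen of kpath L
  | KPghost of kpath L
  | KPzero
  | KPopp of kpterm
  | KPadd of kpterm & kpterm
  | KPscale of K & kpterm
  | KPmul of kpterm & kpterm.

Definition kpvert (v : kvert L) : kpterm := KPgen (kid v).

Definition kpsum (E : seq (kpath L)) : kpterm :=
  foldr (fun l t => KPadd (KPmul (KPgen l) (KPghost l)) t) KPzero E.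

Inductive kprel : kpterm -> kpterm -> Prop :=
  | kprel_refl t : kprel t t
  | kprel_sym t u : kprel t u -> kprel u t
  | kprel_trans t u w : kprel t u -> kprel u w -> kprel t w
  | kprel_oppc t t' : kprel t t' -> kprel (KPopp t) (KPopp t')
  | kprel_addc t t' u u' : kprel t t' -> kprel u u' ->
      kprel (KPadd t u) (KPadd t' u')
  | kprel_scalec c t t' : kprel t t' -> kprel (KPscale c t) (KPscale c t')
  | kprel_mulc t t' u u' : kprel t t' -> kprel u u' ->
      kprel (KPmul t u) (KPmul t' u')
  | kprel_addA t u w : kprel (KPadd t (KPadd u w)) (KPadd (KPadd t u) w)
  | kprel_addC t u : kprel (KPadd t u) (KPadd u t)
  | kprel_add0 t : kprel (KPadd KPzero t) t
  | kprel_addN t : kprel (KPadd (KPopp t) t) KPzero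
  | kprel_scaleA a b t : kprel (KPscale a (KPscale b t)) (KPscale (a * b) t)
  | kprel_scale1 t : kprel (KPscale 1 t) t
  | kprel_scaleDr a t u :
      kprel (KPscale a (KPadd t u)) (KPadd (KPscale a t) (KPscale a u))
  | kprel_scaleDl t a b :
      kprel (KPscale (a + b) t) (KPadd (KPscale a t) (KPscale b t))
  | kprel_mulA t u w : kprel (KPmul t (KPmul u w)) (KPmul (KPmul t u) w)
  | kprel_mulDl t u w :
      kprel (KPmul (KPadd t u) w) (KPadd (KPmul t w) (KPmul u w))
  | kprel_mulDr t u w :
      kprel (KPmul t (KPadd u w)) (KPadd (KPmul t u) (KPmul t w))
  | kprel_scaleAl c t u : kprel (KPscale c (KPmul t u)) (KPmul (KPscale c t) u)
  | kprel_scaleAr c t u : kprel (KPscale c (KPmul t u)) (KPmul t (KPscale c u))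
  | kprel_ghost v : kprel (KPghost (kid v)) (kpvert v)
  | kprel_KP1 v w : kprel (KPmul (kpvert v) (kpvert w))
      (if v == w then kpvert v else KPzero)
  | kprel_KP2 l m (e : ksource l = krange m) :
      kprel (KPmul (KPgen l) (KPgen m)) (KPgen (kcomp e))
  | kprel_KP2' l m (e : ksource l = krange m) :
      kprel (KPmul (KPghost m) (KPghost l)) (KPghost (kcomp e))
  | kprel_KP3 (n : degree k) l m : Lle n l -> Lle n m ->
      kprel (KPmul (KPghost l) (KPgen m))
        (if l == m then kpvert (ksource l) else KPzero)
  | kprel_KP4 v (n : degree k) E : uniq E -> (forall l, l \in E <-> vLle v n l) ->
      kprel (kpvert v) (kpsum E).

HB.instance Definition _ := gen_eqMixin kpterm.
HB.instance Definition _ := gen_choiceMixin kpterm.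

Definition kprelb (t u : kpterm) : bool := `[< kprel t u >].

Lemma kprelb_equiv : equiv_class_of kprelb.
Proof.
split=> [t|t u|u t w]; first by apply/asboolP; exact: kprel_refl.
  by apply/asboolP/asboolP; exact: kprel_sym.
by move=> /asboolP h /asboolP h'; apply/asboolP; exact: kprel_trans h h'.
Qed.

Canonical kprelb_rel := EquivRelPack kprelb_equiv.
Canonical kprelb_enc := defaultEncModRel kprelb.

Definition KP : Type := {eq_quot kprelb}%qT.
HB.instance Definition _ := Choice.on KP.
HB.instance Definition _ := EqQuotient.on KP.

Local Open Scope quotient_scope.

Definition kpcl (t : kpterm) : KP := \pi_KP t.

Lemma kpcl_surj (x : KP) : exists t, kpcl t = x.
Proof. by exists (repr x); exact: reprK. Qed.

Lemma kpclE t u : kpcl t = kpcl u <-> kprel t u.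
Proof.
rewrite /kpcl; split=> [/eqP|h]; first by rewrite piE => /asboolP.
by apply/eqP; rewrite piE; exact/asboolP.
Qed.

Lemma kprel_repr t : kprel (repr (kpcl t)) t.
Proof. by apply/kpclE; exact: reprK. Qed.

Definition KP0 : KP := kpcl KPzero.
Definition KPoppq (x : KP) : KP := kpcl (KPopp (repr x)).
Definition KPaddq (x y : KP) : KP := kpcl (KPadd (repr x) (repr y)).
Definition KPscaleq (c : K) (x : KP) : KP := kpcl (KPscale c (repr x)).
Definition KPmulq (x y : KP) : KP := kpcl (KPmul (repr x) (repr y)).

Lemma kpclN t : KPoppq (kpcl t) = kpcl (KPopp t).
Proof. by apply/kpclE/kprel_oppc/kprel_repr. Qed.
Lemma kpclD t u : KPaddq (kpcl t) (kpcl u) = kpcl (KPadd t u).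
Proof. by apply/kpclE/kprel_addc; exact: kprel_repr. Qed.
Lemma kpclZ c t : KPscaleq c (kpcl t) = kpcl (KPscale c t).
Proof. by apply/kpclE/kprel_scalec/kprel_repr. Qed.
Lemma kpclM t u : KPmulq (kpcl t) (kpcl u) = kpcl (KPmul t u).
Proof. by apply/kpclE/kprel_mulc; exact: kprel_repr. Qed.

Lemma KP_addA : associative KPaddq.
Proof.
move=> a b c; have [x <-] := kpcl_surj a.
have [y <-] := kpcl_surj b; have [z <-] := kpcl_surj c.
rewrite (kpclD y z) (kpclD x y) (kpclD x) (kpclD _ z).
exact/kpclE/kprel_addA.
Qed.
Lemma KP_addC : commutative KPaddq.
Proof.
move=> a b; have [x <-] := kpcl_surj a; have [y <-] := kpcl_surj b.
by rewrite (kpclD x y) (kpclD y x); exact/kpclE/kprel_addC.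
Qed.
Lemma KP_add0 : left_id KP0 KPaddq.
Proof.
move=> a; have [x <-] := kpcl_surj a.
by rewrite (kpclD KPzero x); exact/kpclE/kprel_add0.
Qed.
Lemma KP_addN : left_inverse KP0 KPoppq KPaddq.
Proof.
move=> a; have [x <-] := kpcl_surj a.
by rewrite (kpclN x) (kpclD _ x); exact/kpclE/kprel_addN.
Qed.

HB.instance Definition _ :=
  GRing.isZmodule.Build KP KP_addA KP_addC KP_add0 KP_addN.

Lemma KP_scaleA (c d : K) a : KPscaleq c (KPscaleq d a) = KPscaleq (c * d) a.
Proof.
have [x <-] := kpcl_surj a.
by rewrite (kpclZ d x) (kpclZ c) (kpclZ _ x); exact/kpclE/kprel_scaleA.
Qed.
Lemma KP_scale1 : left_id 1 KPscaleq.
Proof.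
move=> a; have [x <-] := kpcl_surj a.
by rewrite (kpclZ 1 x); exact/kpclE/kprel_scale1.
Qed.
Lemma KP_scaleDr : right_distributive KPscaleq +%R.
Proof.
move=> c a b; have [x <-] := kpcl_surj a; have [y <-] := kpcl_surj b.
rewrite [_ + _](kpclD x y) (kpclZ c x) (kpclZ c y) (kpclZ c).
by rewrite [RHS](kpclD _ _); exact/kpclE/kprel_scaleDr.
Qed.
Lemma KP_scaleDl a : {morph KPscaleq^~ a : c d / c + d}.
Proof.
move=> c d /=; have [x <-] := kpcl_surj a.
rewrite (kpclZ c x) (kpclZ d x) (kpclZ _ x).
by rewrite [RHS](kpclD _ _); exact/kpclE/kprel_scaleDl.
Qed.

HB.instance Definition _ := GRing.Zmodule_isLmodule.Build K KP
  KP_scaleA KP_scale1 KP_scaleDr KP_scaleDl.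

Lemma KP_mulA : associative KPmulq.
Proof.
move=> a b c; have [x <-] := kpcl_surj a.
have [y <-] := kpcl_surj b; have [z <-] := kpcl_surj c.
rewrite (kpclM y z) (kpclM x y) (kpclM x) (kpclM _ z).
exact/kpclE/kprel_mulA.
Qed.
Lemma KP_mulDl : left_distributive KPmulq +%R.
Proof.
move=> a b c; have [x <-] := kpcl_surj a.
have [y <-] := kpcl_surj b; have [z <-] := kpcl_surj c.
rewrite [kpcl x + _](kpclD x y) (kpclM x z) (kpclM y z) (kpclM _ z).
by rewrite [RHS](kpclD _ _); exact/kpclE/kprel_mulDl.
Qed.
Lemma KP_mulDr : right_distributive KPmulq +%R.
Proof.
move=> a b c; have [x <-] := kpcl_surj a.
have [y <-] := kpcl_surj b; have [z <-] := kpcl_surj c.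
rewrite [kpcl y + _](kpclD y z) (kpclM x y) (kpclM x z) (kpclM x).
by rewrite [RHS](kpclD _ _); exact/kpclE/kprel_mulDr.
Qed.

HB.instance Definition _ := isNuRing.Build KP KP_mulA KP_mulDl KP_mulDr.

Lemma kpcl_add t u : kpcl (KPadd t u) = kpcl t + kpcl u.
Proof. exact/esym/kpclD. Qed.
Lemma kpcl_opp t : kpcl (KPopp t) = - kpcl t.
Proof. exact/esym/kpclN. Qed.
Lemma kpcl_scale c t : kpcl (KPscale c t) = c *: kpcl t.
Proof. exact/esym/kpclZ. Qed.
Lemma kpcl_mul t u : kpcl (KPmul t u) = kpcl t ** kpcl u.
Proof. exact/esym/kpclM. Qed.

Lemma KP_scaleAl (c : K) (a b : KP) : c *: (a ** b) = (c *: a) ** b.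
Proof.
have [x <-] := kpcl_surj a; have [y <-] := kpcl_surj b.
by rewrite -kpcl_mul -!kpcl_scale -kpcl_mul; exact/kpclE/kprel_scaleAl.
Qed.
Lemma KP_scaleAr (c : K) (a b : KP) : c *: (a ** b) = a ** (c *: b).
Proof.
have [x <-] := kpcl_surj a; have [y <-] := kpcl_surj b.
by rewrite -kpcl_mul -!kpcl_scale -kpcl_mul; exact/kpclE/kprel_scaleAr.
Qed.

HB.instance Definition _ := isNuAlgebra.Build K KP KP_scaleAl KP_scaleAr.

(* [kps l] is s_l and [kpt l] is s_{l^*}. *)
Definition kps (l : kpath L) : KP := kpcl (KPgen l).
Definition kpt (l : kpath L) : KP := kpcl (KPghost l).

Lemma kpcl_sum E : kpcl (kpsum E) = \sum_(l <- E) kps l ** kpt l.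
Proof.
elim: E => [|l E IH]; first by rewrite big_nil.
by rewrite big_cons -IH /= kpcl_add kpcl_mul.
Qed.

Lemma KP_familyP : KP_family kps kpt.
Proof.
split.
- by move=> v; exact/kpclE/kprel_ghost.
- move=> v w; rewrite -kpcl_mul.
  by have /kpclE -> := kprel_KP1 v w; case: eqP.
- move=> l m e; rewrite -!kpcl_mul; split; apply/kpclE.
    exact: kprel_KP2.
  exact: kprel_KP2'.
- move=> n l m ln mn; rewrite -kpcl_mul.
  by have /kpclE -> := kprel_KP3 ln mn; case: eqP.
- move=> v n E uE hE; rewrite -kpcl_sum; exact/kpclE/(kprel_KP4 uE hE).
Qed.

Section Universal.
Variables (A : nuAlgType K) (S T : kpath L -> A).
Hypothesis ST : KP_family S T.

Fixpoint kpeval (t : kpterm) : A :=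
  match t with
  | KPgen l => S l
  | KPghost l => T l
  | KPzero => 0
  | KPopp t => - kpeval t
  | KPadd t u => kpeval t + kpeval u
  | KPscale c t => c *: kpeval t
  | KPmul t u => kpeval t ** kpeval u
  end.

Lemma kpeval_rel t u : kprel t u -> kpeval t = kpeval u.
Proof.
case: ST => h0 h1 h2 h3 h4.
elim=> //=; try by move=> *; congruence.
- by move=> *; rewrite addrA.
- by move=> *; rewrite addrC.
- by move=> *; rewrite add0r.
- by move=> *; rewrite addNr.
- by move=> *; rewrite scalerA.
- by move=> *; rewrite scale1r.
- by move=> *; rewrite scalerDr.
- by move=> *; rewrite scalerDl.
- by move=> *; rewrite nmulA.
- by move=> *; rewrite nmulDl.
- by move=> *; rewrite nmulDr.
- by move=> *; rewrite nscaleAl.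
- by move=> *; rewrite nscaleAr.
- by move=> v w; rewrite h1; case: eqP.
- by move=> l m e; have [] := h2 l m e.
- by move=> l m e; have [] := h2 l m e.
- by move=> n l m ln mn; rewrite (h3 n) //; case: eqP.
move=> v n E uE hE; rewrite (h4 v n E) // => {uE hE}.
by elim: E => [|l E IH] /=; rewrite ?big_nil // big_cons IH.
Qed.

Lemma KP_universal : exists! f : KP -> A,
  [/\ forall l, f (kps l) = S l, forall l, f (kpt l) = T l,
      forall x y, f (x + y) = f x + f y,
      forall c x, f (c *: x) = c *: f x
    & forall x y, f (x ** y) = f x ** f y].
Proof.
exists (fun x => kpeval (repr x)); split.
  split.
  - by move=> l; rewrite (kpeval_rel (kprel_repr _)).
  - by move=> l; rewrite (kpeval_rel (kprel_repr _)).
  - by move=> x y; rewrite (kpeval_rel (kprel_repr _)).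
  - by move=> c x; rewrite (kpeval_rel (kprel_repr _)).
  - by move=> x y; rewrite (kpeval_rel (kprel_repr _)).
move=> f [fs ft fD fZ fM]; apply: funext => x.
have [t <-] := kpcl_surj x; rewrite (kpeval_rel (kprel_repr t)).
have f0 : f 0 = 0 by apply: (addrI (f 0)); rewrite -fD !addr0.
have fN y : f (- y) = - f y by apply/eqP; rewrite -addr_eq0 -fD addNr f0.
elim: t => [l|l||t IH|t IH u IH'|c t IH|t IH u IH'] /=.
- by rewrite -fs.
- by rewrite -ft.
- by rewrite -f0.
- by rewrite kpcl_opp fN IH.
- by rewrite kpcl_add fD IH IH'.
- by rewrite kpcl_scale fZ IH.
- by rewrite kpcl_mul fM IH IH'.
Qed.

End Universal.

End KumjianPask.

Arguments kps K {k L} l.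
Arguments kpt K {k L} l.

(* Main.v *)
Require Import Defs.
From HB Require Import structures.
From mathcomp Require Import all_boot all_order all_algebra.
From mathcomp Require Import mathcomp_extra boolp classical_sets cardinality.

(* For [a] in an s-unital ring [R], the elements [x] with
   [a \oplus x \precsim a] form an ideal I(a), and [a] is properly infinite
   iff it lies in I(a). If an idempotent [p \precsim a] is properly infinite,
   then [p] lies in I(a).

   (3) => (2): the vertices [w] with [s_w] in I(a) form a saturated hereditary
   set [H]. If [a] is not in I(a), aperiodicity of [L \ L H] lets one compress
   [a] to [x a y = s_w] modulo I(a) with [w] outside [H]. Then [s_w \precsim a],
   and [s_w] being properly infinite forces [w] into [H].

   (1) => (3): let [a = s_v] be outside I(a), with [H] as before, and choose a
   boundary path [P] from [v] avoiding [H]. Two distinct paths in [v L^{<= n}]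
   whose sources lead to a common vertex [w] give
   [s_w \oplus s_w \precsim s_v], and pure infiniteness turns this into [w] in
   [H]. Hence [P] is the only boundary path from [v] in its tail equivalence
   class [X], and [s_v] acts on functions on [X] with rank one. If [X = {P}],
   this action is a character of the algebra, whose kernel has a division ring
   quotient; otherwise some element of the ideal of [s_v] acts with rank at
   least two and so is not below [s_v]. *)

Set Implicit Arguments.
Unset Strict Implicit.
Unset Printing Implicit Defensive.

Import GRing.Theory.
Local Open Scope classical_set_scope.
Local Open Scope ring_scope.

(** * Paths and degrees *)


Section Degrees.
Variable k : nat.
Implicit Types m n p q : degree k.

Lemma daddE p q i : (p + q) i = (p i + q i)%N.
Proof. by rewrite ffunE. Qed.

Lemma dbaseE (i : 'I_k) : dbase i i = 1%N.
Proof. by rewrite ffunE eqxx. Qed.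

Definition djoin p q : degree k := [ffun i => maxn (p i) (q i)].

Lemma dle_joinl p q : dle p (djoin p q).
Proof. by apply/dleP => i; rewrite ffunE leq_maxl. Qed.

Lemma dle_joinr p q : dle q (djoin p q).
Proof. by apply/dleP => i; rewrite ffunE leq_maxr. Qed.

Lemma dle_addl p q : dle q (p + q).
Proof. by rewrite addrC dle_addr. Qed.

Lemma dle_add_base p i : ~~ dle (p + dbase i) p.
Proof.
by apply/negP => /dleP/(_ i); rewrite daddE dbaseE addn1 ltnn.
Qed.

Lemma dle_add2l p q n : dle (p + q) (p + n) = dle q n.
Proof.
by apply/dleP/dleP => h i; have := h i; rewrite !daddE leq_add2l.
Qed.

Lemma dle_add_dbase p i n : dle p n -> (p i < n i)%N -> dle (p + dbase i) n.
Proof.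
move=> /dleP h pi; apply/dleP => j; rewrite daddE ffunE.
by case: eqP => [->|_]; rewrite ?addn1 ?addn0.
Qed.

Lemma dle_finite n : finite_set [set m | dle m n].
Proof.
pose N := \max_(i < k) n i.
apply: (@sub_finite_set _ _ ((fun f : {ffun 'I_k -> 'I_N.+1} =>
  [ffun i => val (f i)] : degree k) @` setT)); last first.
  exact/finite_image/finite_finset.
move=> m /dleP mn; exists [ffun i => inord (m i)] => //.
apply/ffunP => i; rewrite !ffunE /= inordK // ltnS.
by apply: leq_trans (mn i) _; exact: leq_bigmax.
Qed.

End Degrees.

Section Paths.
Variables (k : nat) (L : kgraph k).
Implicit Types (a b c l : kpath L) (v w : kvert L) (m n p q : degree k).

(* Composition made total, with the junk value [a] on non-composable paths. *)
Definition kcat a b : kpath L :=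
  match ksource a =P krange b with ReflectT e => kcomp e | _ => a end.

Lemma kcatE a b (e : ksource a = krange b) : kcat a b = kcomp e.
Proof. by rewrite /kcat; case: eqP => // e'; exact: kcomp_irr. Qed.

Lemma krange_cat a b : krange (kcat a b) = krange a.
Proof. by rewrite /kcat; case: eqP => // e; exact: krange_comp. Qed.

Lemma ksource_cat a b : ksource a = krange b ->
  ksource (kcat a b) = ksource b.
Proof. by move=> e; rewrite kcatE ksource_comp. Qed.

Lemma kdeg_cat a b : ksource a = krange b ->
  kdeg (kcat a b) = kdeg a + kdeg b.
Proof. by move=> e; rewrite kcatE kdeg_comp. Qed.

Lemma kcatA a b c : ksource a = krange b -> ksource b = krange c ->
  kcat (kcat a b) c = kcat a (kcat b c).
Proof.
move=> ab bc; rewrite (kcatE ab) (kcatE bc).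
have e1 : ksource (kcomp ab) = krange c by rewrite ksource_comp.
have e2 : ksource a = krange (kcomp bc) by rewrite krange_comp.
by rewrite (kcatE e1) (kcatE e2); exact: kcompA.
Qed.

Lemma kcat1l v a : v = krange a -> kcat (kid v) a = a.
Proof.
by move=> ->; rewrite kcatE ?ksource_id // => e; exact: kcomp_idl.
Qed.

Lemma kcat1r v a : v = ksource a -> kcat a (kid v) = a.
Proof.
by move=> ->; rewrite kcatE ?krange_id // => e; exact: kcomp_idr.
Qed.

Lemma kinit_cat a b : ksource a = krange b -> kinit (kcat a b) (kdeg a) = a.
Proof. by move=> e; rewrite kcatE; have [] := kfact_uniq e. Qed.

Lemma ktail_cat a b : ksource a = krange b -> ktail (kcat a b) (kdeg a) = b.
Proof. by move=> e; rewrite kcatE; have [] := kfact_uniq e. Qed.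

Lemma kinit_catl a b p : ksource a = krange b -> dle p (kdeg a) ->
  kinit (kcat a b) p = kinit a p.
Proof. by move=> e pa; rewrite kcatE; exact: kinit_comp. Qed.

Lemma kcat_inj a b a' b' : ksource a = krange b -> ksource a' = krange b' ->
  kdeg a = kdeg a' -> kcat a b = kcat a' b' -> a = a' /\ b = b'.
Proof.
move=> e e' d E; split; first by rewrite -(kinit_cat e) E d kinit_cat.
by rewrite -(ktail_cat e) E d ktail_cat.
Qed.

Lemma kcat_injr a b b' : ksource a = krange b -> ksource a = krange b' ->
  kcat a b = kcat a b' -> b = b'.
Proof. by move=> e e' /(kcat_inj e e' erefl)[]. Qed.

Lemma kcat_split l p : dle p (kdeg l) ->
  exists a b, [/\ ksource a = krange b, l = kcat a b & kdeg a = p].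
Proof.
move=> /kinit_tailP[da _ [e <-]].
by exists (kinit l p), (ktail l p); rewrite (kcatE e).
Qed.

Lemma edge_of_deg a i : (0 < kdeg a i)%N -> vLn (krange a) (dbase i) !=set0.
Proof.
move=> /dbase_le/kcat_split[b [c [_ -> db]]].
by exists b; split; rewrite ?krange_cat.
Qed.

Lemma Lle_deg a : Lle (kdeg a) a.
Proof.
by split=> [|i]; rewrite ?dle_refl // => /(negP (dle_add_base _ _)).
Qed.

Lemma Lle_cat a b n : ksource a = krange b -> Lle n b -> Lle (kdeg a + n) (kcat a b).
Proof.
move=> e [bn bmax]; split=> [|i]; rewrite kdeg_cat //; first by rewrite dle_add2l.
by rewrite -addrA dle_add2l ksource_cat //; exact: bmax.
Qed.

Lemma Lle_cat_sub a b n : ksource a = krange b -> dle (kdeg a) n ->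
  Lle (dsub n (kdeg a)) b -> Lle n (kcat a b).
Proof. by move=> e /dsubK {2}<-; exact: Lle_cat. Qed.

Lemma Lle_edge a n i : Lle n a -> (kdeg a i < n i)%N ->
  ~ (vLn (ksource a) (dbase i) !=set0).
Proof.
move=> [an amax] ain; rewrite amax ?dle_add_dbase // => [[]] //.
Qed.

(** [b] can be factored to begin with an edge of colour [i], so maximality of [a] below [n] leaves
    no room in that coordinate. *)
Lemma Lle_deg_ext a b n i : Lle n a -> ksource a = krange b ->
  (0 < kdeg b i)%N -> kdeg a i = n i.
Proof.
move=> an e bi; apply/eqP; rewrite eqn_leq; case: (an) => /dleP -> _ /=.
rewrite leqNgt; apply/negP => /(Lle_edge an); apply.
by rewrite e; exact: edge_of_deg.
Qed.

Definition kprefix a c := exists2 b, ksource a = krange b & c = kcat a b.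

Lemma kprefix_refl a : kprefix a a.
Proof. by exists (kid (ksource a)); rewrite ?krange_id ?kcat1r. Qed.

Lemma kprefix_trans b a c : kprefix a b -> kprefix b c -> kprefix a c.
Proof.
move=> [d ad ->] [e]; rewrite ksource_cat // => de ->.
by exists (kcat d e); rewrite ?krange_cat ?kcatA.
Qed.

Lemma kprefix_cat a b : ksource a = krange b -> kprefix a (kcat a b).
Proof. by exists b. Qed.

Lemma kprefix_range a c : kprefix a c -> krange c = krange a.
Proof. by move=> [b _ ->]; rewrite krange_cat. Qed.

Lemma kprefix_id a : kprefix (kid (krange a)) a.
Proof. by exists a; rewrite ?ksource_id ?kcat1l. Qed.

Lemma kprefix_cat2 a b c : ksource a = krange b -> ksource a = krange c ->
  kprefix (kcat a b) (kcat a c) -> kprefix b c.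
Proof.
move=> ab ac [d]; rewrite ksource_cat // => bd E; exists d => //.
by move: E; rewrite kcatA // => /kcat_injr -> //; rewrite krange_cat.
Qed.

Lemma kcat_prefix a b c : ksource a = krange b -> kprefix b c ->
  kprefix (kcat a b) (kcat a c).
Proof.
by move=> ab [d bd ->]; exists d; rewrite ?ksource_cat ?kcatA.
Qed.

Lemma kprefix_dle a b c : kprefix a c -> kprefix b c ->
  dle (kdeg a) (kdeg b) -> kprefix a b.
Proof.
move=> [d ad Ed] [e be Ee] /kcat_split[a' [f [af Ef da]]].
move: Ee; rewrite Ef Ed kcatA //; last by rewrite -be Ef ksource_cat.
move=> /kcat_inj[] //; first by rewrite krange_cat.
by move=> -> _; exists f.
Qed.

(** If [b] exceeded [a] in coordinate [i], the part of [c] after [a] would have positive degree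
    there, and maximality would put [a] level with [n] in that coordinate. *)
Lemma Lle_prefix_dle a b c n : Lle n a -> dle (kdeg b) n ->
  kprefix a c -> kprefix b c -> dle (kdeg b) (kdeg a).
Proof.
move=> an /dleP bn [d ad ->] [e be E]; apply/dleP => i.
rewrite leqNgt; apply/negP => abi.
have : (kdeg (kcat a d) i = kdeg (kcat b e) i) by rewrite E.
rewrite !kdeg_cat // !daddE => dE.
have di : (0 < kdeg d i)%N.
  by rewrite -(ltn_add2l (kdeg a i)) addn0 dE ltn_addr.
by move: abi; rewrite (Lle_deg_ext an ad di) ltnNge bn.
Qed.

Lemma Lle_prefix a b c n : Lle n a -> dle (kdeg b) n ->
  kprefix a c -> kprefix b c -> kprefix b a.
Proof.
move=> an bn ac bc; apply: (kprefix_dle bc ac).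
exact: Lle_prefix_dle an bn ac bc.
Qed.

(** The degree comparison applies in both directions, and unique factorisation concludes. Hence a
    boundary path has at most one initial segment in [Lle n]. *)
Lemma Lle_prefix_eq a b c n : Lle n a -> Lle n b ->
  kprefix a c -> kprefix b c -> a = b.
Proof.
move=> an bn ac bc.
have ab : kdeg a = kdeg b.
  have /dleP h1 := Lle_prefix_dle an (proj1 bn) ac bc.
  have /dleP h2 := Lle_prefix_dle bn (proj1 an) bc ac.
  by apply/ffunP => i; apply/eqP; rewrite eqn_leq h1 h2.
case: ac bc => [d ad ->] [e be].
by move=> /kcat_inj[].
Qed.

Lemma kcat_neq_deg0 a b i : ksource a = krange b ->
  ~ (vLn (ksource a) (dbase i) !=set0) -> kdeg (kcat a b) i = kdeg a i.
Proof.
move=> ab na; rewrite kdeg_cat // daddE; case E : (kdeg b i) => [|d]; rewrite ?addn0 //.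
by case: na; rewrite ab; apply: edge_of_deg; rewrite E.
Qed.

Lemma Lle_exists v n : vLle v n !=set0.
Proof.
(* [N] bounds the total degree missing below [n]; a path that is not maximal can be lengthened by an
   edge, which lowers it. *)
suff ext N l : dle (kdeg l) n -> (\sum_i (n i - kdeg l i) < N)%N ->
    exists2 c, kprefix l c & Lle n c.
  have [|c lc cn] := @ext _ (kid v) _ (ltnSn _).
    by rewrite kdeg_id; apply/dleP => i; rewrite ffunE.
  by exists c; split=> //; rewrite (kprefix_range lc) krange_id.
elim: N l => // N IH l ln lN.
have [lmax|] := pselect (Lle n l); first by exists l => //; exact: kprefix_refl.
move=> /not_andP[//|/existsNP[i /not_implyP[lin /eqP/set0P[e [el de]]]]].
have le : ksource l = krange e by [].
have dle' : kdeg (kcat l e) = kdeg l + dbase i by rewrite kdeg_cat ?de.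
have lni : (kdeg l i < n i)%N.
  by have /dleP/(_ i) := lin; rewrite daddE dbaseE addn1.
have [||c lc cn] := IH (kcat l e).
- by rewrite dle'.
- rewrite dle' -ltnS; apply: leq_trans lN; rewrite ltnS.
  rewrite [X in (X < _)%N](bigD1 i) //= [X in (_ < X)%N](bigD1 i) //=.
  rewrite -addSn leq_add //; last first.
    by apply: leq_sum => j _; rewrite daddE leq_sub2l // leq_addr.
  by rewrite daddE dbaseE addn1 subnSK.
by exists c => //; apply: kprefix_trans lc; exact: kprefix_cat.
Qed.

(** The sets [vLle v n] are never empty, so their sources cannot all lie in the empty set. *)
Lemma saturated0 : saturated (set0 : set (kvert L)).
Proof.
by move=> v n; have [l lv] := Lle_exists v n => /(_ (ksource l)); apply; exists l.
Qed.

Lemma Lle_list : row_finite L -> forall v n, exists2 E : seq (kpath L),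
  uniq E & forall l, l \in E <-> vLle v n l.
Proof.
move=> rf v n; have : finite_set (vLle v n).
  apply: (@sub_finite_set _ _ (\bigcup_(m in [set m | dle m n]) vLn v m)).
    by move=> l [lv [ln _]]; exists (kdeg l).
  apply: bigcup_finite => [|m _]; first exact: dle_finite.
  exact: rf.
move=> /finite_seqP[s vs]; exists (undup s); first exact: undup_uniq.
by move=> l; rewrite mem_undup vs.
Qed.

(** Cut [l] at the minimum of [n] and its degree. In a coordinate where the cut stays below [n], the
    rest of [l] has degree zero, so local convexity would carry an edge at the cut to the source of
    [l], against maximality below [N]. *)
Lemma Lle_kinit : locally_convex L -> forall n N l, dle n N -> Lle N l ->
  exists2 a, kprefix a l & Lle n a.
Proof.
move=> lc n N l /dleP nN lN.
pose p : degree k := [ffun i => minn (kdeg l i) (n i)].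
have pl : dle p (kdeg l) by apply/dleP => i; rewrite ffunE geq_minl.
have [a [b [ab lE da]]] := kcat_split pl.
exists a; first by exists b.
split=> [|i]; rewrite da; first by apply/dleP => i; rewrite ffunE geq_minr.
move=> /dleP/(_ i); rewrite daddE dbaseE ffunE addn1 => pni.
have lni : (kdeg l i < n i)%N.
  by move: pni; rewrite gtn_min ltnn orbF.
apply/eqP; apply: contrapT => /negP/set0P ane.
apply: (Lle_edge lN (leq_trans lni (nN i))).
rewrite lE ksource_cat //; apply: locally_convex_path lc _ _ _ _; last by rewrite -ab.
have : kdeg l i = (kdeg a i + kdeg b i)%N by rewrite {1}lE kdeg_cat // daddE.
rewrite da ffunE (minn_idPl (ltnW lni)) => /eqP.
by rewrite -[X in X == _]addn0 eqn_add2l eq_sym => /eqP.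
Qed.

End Paths.

(** * Absorption in non-unital rings *)


Section NuRings.
Variable R : nuRingType.
Implicit Types (a b e p x y z : R).

Lemma nmul_suml (I : Type) (r : seq I) (P : pred I) (F : I -> R) y :
  (\sum_(i <- r | P i) F i) ** y = \sum_(i <- r | P i) F i ** y.
Proof.
by apply: (big_morph (fun x => x ** y)) => [a b|]; rewrite ?nmulDl ?nmul0l.
Qed.

Lemma nmul_sumr (I : Type) (r : seq I) (P : pred I) (F : I -> R) y :
  y ** (\sum_(i <- r | P i) F i) = \sum_(i <- r | P i) y ** F i.
Proof.
by apply: (big_morph (fun x => y ** x)) => [a b|]; rewrite ?nmulDr ?nmul0r.
Qed.

Lemma precsim1P a b :
  precsim (mx1 a) (mx1 b) <-> exists x y, a = x ** b ** y.
Proof.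
split=> [[x [y /matrixP/(_ 0 0)]]|[x [y E]]].
  by rewrite !mxE big_ord1 mxE big_ord1 !mxE; exists (x 0 0), (y 0 0).
exists (mx1 x), (mx1 y); apply/matrixP => i j.
by rewrite !mxE big_ord1 mxE big_ord1 !mxE.
Qed.

(* Elementwise form of [a \oplus x \precsim a]. *)
Definition absorbs a x := exists x1 x2 y1 y2,
  [/\ x1 ** a ** y1 = a, x1 ** a ** y2 = 0,
      x2 ** a ** y1 = 0 & x2 ** a ** y2 = x].

Lemma properly_infiniteP a : properly_infinite a <-> a <> 0 /\ absorbs a a.
Proof.
have E (x : 'M[R]_(1 + 1, 1)) (y : 'M[R]_(1, 1 + 1)) i j :
    numulmx (numulmx x (mx1 a)) y i j = x i 0 ** a ** y 0 j.
  by rewrite !mxE big_ord1 mxE big_ord1 !mxE.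
split=> -[a0 h]; split=> //.
  case: h => x [y /matrixP xy].
  exists (x (lshift 1 0) 0), (x (rshift 1 0) 0),
    (y 0 (lshift 1 0)), (y 0 (rshift 1 0)).
  rewrite -!E -!xy /mxoplus.
  by rewrite block_mxEul block_mxEur block_mxEdl block_mxEdr !mxE.
case: h => x1 [x2 [y1 [y2 [h11 h12 h21 h22]]]].
exists (col_mx (mx1 x1) (mx1 x2)), (row_mx (mx1 y1) (mx1 y2)).
apply/matrixP => i j; rewrite E /mxoplus.
case: (split_ordP i) => i' ->; case: (split_ordP j) => j' ->;
  rewrite ?col_mxEu ?col_mxEd ?row_mxEl ?row_mxEr.
- by rewrite !mxE h11.
- by rewrite !mxE h12.
- by rewrite !mxE h21.
- by rewrite !mxE h22.
Qed.

Definition s_unital := forall x : R, exists2 e, e ** x = x & x ** e = x.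

Definition is_ideal (I : R -> Prop) :=
  [/\ I 0, forall x y, I x -> I y -> I (x + y) &
      forall x r s, I x -> I (r ** x ** s)].

Section Absorption.
Hypothesis unitR : s_unital.

(** For sums, the copy of [a] reproduced while absorbing [x] is fed into the absorption of [z]. For
    zero, a local unit of [a] suffices. *)
Lemma absorbs_ideal a : is_ideal (absorbs a).
Proof.
split.
- have [e ea ae] := unitR a; exists e, 0, e, 0.
  by rewrite ea ae !(nmul0l, nmul0r).
- move=> x z [x1 [x2 [y1 [y2 [a1 a2 a3 a4]]]]] [u1 [u2 [w1 [w2 [b1 b2 b3 b4]]]]].
  exists (u1 ** x1), (u2 ** x1 + x2), (y1 ** w1), (y1 ** w2 + y2).
  have A u w : (u ** x1) ** a ** (y1 ** w) = u ** a ** w.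
    by rewrite -[in RHS]a1 !nmulA.
  have B u : (u ** x1) ** a ** y2 = 0 by rewrite -!nmulA (nmulA x1) a2 nmul0r.
  have C w : x2 ** a ** (y1 ** w) = 0 by rewrite nmulA a3 nmul0l.
  split; first by rewrite A.
  + by rewrite nmulDr A B b2 addr0.
  + by rewrite !nmulDl A C b3 addr0.
  + by rewrite nmulDr !nmulDl A B C b4 a4 add0r addr0 addrC.
- move=> x r s [x1 [x2 [y1 [y2 [a1 a2 a3 a4]]]]].
  exists x1, (r ** x2), y1, (y2 ** s); split=> //.
  + by rewrite nmulA a2 nmul0l.
  + by rewrite -!nmulA (nmulA x2) a3 nmul0r.
  + by rewrite -a4 !nmulA.
Qed.

(** The reproduced copy of [a] is compressed to [x ** a ** y], the other slot supplies [z], and the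
    cross terms vanish. *)
Lemma absorbs_add_below a p x y z : absorbs a z -> p = x ** a ** y + z ->
  exists x' y', p = x' ** a ** y'.
Proof.
move=> [x1 [x2 [y1 [y2 [a1 a2 a3 a4]]]]] ->.
exists (x ** x1 + x2), (y1 ** y + y2).
rewrite nmulDr !nmulDl.
have -> : (x ** x1) ** a ** (y1 ** y) = x ** a ** y by rewrite -[in RHS]a1 !nmulA.
have -> : (x ** x1) ** a ** y2 = 0 by rewrite -!nmulA (nmulA x1) a2 nmul0r.
by rewrite nmulA a3 nmul0l a4 add0r addr0.
Qed.

(* With [q = a y x], an idempotent equivalent to [p], one has
   [a = (a - q a) + q a] and [q a] is below [p], which absorbs itself. *)
Lemma absorbs_idem a p x y : p ** p = p -> absorbs p p ->
  p = x ** a ** y -> absorbs a p.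
Proof.
move=> pp [u1 [u2 [w1 [w2 [c11 c12 c21 c22]]]]] pE.
have [e ea ae] := unitR a.
(* Cutting down by [p] makes [a ** Y ** X] an idempotent, with [X] and [a ** Y] implementing its
   equivalence with [p]. *)
pose X := p ** x; pose Y := y ** p.
have XaY : X ** a ** Y = p.
  by rewrite /X /Y -!nmulA (nmulA x) (nmulA (x ** a)) -pE nmulA pp pp.
have aYp : a ** Y ** p = a ** Y by rewrite /Y -!nmulA pp.
have pXa : p ** (X ** a) = X ** a by rewrite /X !nmulA pp.
(* Off the idempotent, [r1] and [s1] keep the local unit; on it they carry [u1] and [w1] transported
   from [p]. The copy of [p] is extracted by [u2] and [w2]. *)
pose r1 := e - a ** Y ** X + a ** Y ** u1 ** X.
pose s1 := e - Y ** (X ** a) + Y ** (w1 ** (X ** a)).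
exists r1, (u2 ** X), s1, (Y ** w2).
have r1a : r1 ** a = a - a ** Y ** (X ** a) + a ** Y ** u1 ** (X ** a).
  by rewrite /r1 !nmulDl nmulNl ea !nmulA.
have r1aY : r1 ** a ** Y = a ** Y ** (u1 ** p).
  rewrite r1a !nmulDl nmulNl -!(nmulA (a ** Y)) -!(nmulA u1) XaY aYp subrr add0r.
  by [].
have Xas1 : X ** a ** s1 = p ** w1 ** (X ** a).
  have XaT t : X ** a ** (Y ** t) = p ** t by rewrite nmulA XaY.
  by rewrite /s1 !nmulDr nmulNr !XaT pXa -(nmulA X a) ae subrr add0r nmulA.
split.
- have E2 : r1 ** a ** (Y ** (X ** a)) = a ** Y ** u1 ** (X ** a).
    by rewrite nmulA r1aY -!(nmulA (a ** Y)) -(nmulA u1) pXa.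
  have E3 : r1 ** a ** (Y ** (w1 ** (X ** a))) = a ** Y ** (X ** a).
    by rewrite nmulA r1aY nmulA -(nmulA (a ** Y)) c11 aYp.
  rewrite /s1 !nmulDr nmulNr E2 E3 -(nmulA r1) ae r1a addrK.
  exact: subrK.
- by rewrite nmulA r1aY -!nmulA (nmulA u1) c12 !nmul0r.
- by rewrite -(nmulA u2 X) -(nmulA u2 (X ** a)) Xas1 !nmulA c21 !nmul0l.
- by rewrite nmulA -(nmulA u2) -(nmulA u2) XaY c22.
Qed.

End Absorption.
End NuRings.


(** * Properly infinite elements, division ring quotients and pure infiniteness *)

Section PurelyInfinite.
Variable R : nuRingType.
Implicit Types (a b p q x y z : R).

(** Induction on the number of summands: one copy of [a] serves the first summand, the other the
    remaining sum. *)
Lemma absorbs_self_RaR a b : absorbs a a -> in_RaR a b ->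
  exists x y, b = x ** a ** y.
Proof.
move=> [x1 [x2 [y1 [y2 [a1 a2 a3 a4]]]]] [n [r [s ->]]].
elim: n r s => [|n IH] r s.
  by rewrite big_ord0; exists 0, 0; rewrite nmul0r.
rewrite big_ord_recl; have [x [y ->]] := IH (r \o lift ord0) (s \o lift ord0).
exists (r ord0 ** x1 + x ** x2), (y1 ** s ord0 + y2 ** y).
have C u i j c w : i ** a ** j = c -> (u ** i) ** a ** (j ** w) = u ** c ** w.
  by move=> <-; rewrite !nmulA.
rewrite nmulDr !nmulDl (C _ _ _ _ _ a1) (C _ _ _ _ _ a2) (C _ _ _ _ _ a3).
by rewrite (C _ _ _ _ _ a4) !nmul0r !nmul0l addr0 add0r.
Qed.

(** Lift the identity of the quotient to [a]. Proper infiniteness of [a] gives, modulo [I],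
    [x1 ** y1 = e], [x1 ** y2 = 0] and [x2 ** y2 = e]. Cancelling [x1] kills [y2], hence [e]. *)
Lemma no_division_quotient : properly_purely_infinite R ->
  forall I : nuIdeal R, ~ is_division_ring (nuquot I).
Proof.
move=> ppi I [e [e0 e1 einv]]; have [a ae] := nuproj_surj e.
have pM (x y : R) : nuproj I (x ** y) = nuproj I x ** nuproj I y.
  by rewrite -nuprojM.
have p0 : nuproj I 0 = 0 by apply: (addIr (nuproj I 0)); rewrite nuprojD !add0r.
have cancel0 (z w : nuquot I) : z ** w = 0 -> z <> 0 -> w = 0.
  move=> zw /eqP/einv[z' [_ z'z]].
  by rewrite -(proj1 (e1 w)) -z'z -nmulA zw nmul0r.
have a0 : a <> 0 by move=> a0; move: e0; rewrite -ae a0 p0 eqxx.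
have /properly_infiniteP[_ [x1 [x2 [y1 [y2 [a1 a2 a3 a4]]]]]] := ppi a a0.
have E x y z : x ** a ** y = z -> nuproj I x ** nuproj I y = nuproj I z.
  by move=> <-; rewrite !pM ae (proj2 (e1 _)).
move: (E _ _ _ a1) (E _ _ _ a2) (E _ _ _ a4); rewrite p0 ae => b1 b2 b4.
have x1n : nuproj I x1 <> 0.
  by move=> x10; move/eqP: e0; apply; rewrite -b1 x10 nmul0l.
by move/eqP: e0; apply; rewrite -b4 (cancel0 _ _ b2 x1n) nmul0r.
Qed.

Lemma ppi_purely_infinite : properly_purely_infinite R -> purely_infinite R.
Proof.
move=> ppi; split; first exact: no_division_quotient.
move=> a b ab; apply/precsim1P; have [a0|a0] := pselect (a = 0); last first.
  by apply: absorbs_self_RaR ab; have /properly_infiniteP[] := ppi a a0.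
case: ab => n [r [s ->]]; exists 0, 0; rewrite nmul0r big1 // => i _.
by rewrite a0 nmul0r nmul0l.
Qed.

(* The two orthogonal copies of [q] below [p] add up to an element of the ideal
   generated by [q], which is then below [q]; hence [q] absorbs itself. *)
Lemma absorbs_two_copies p q x1 x2 y1 y2 : s_unital R -> purely_infinite R ->
    q ** q = q -> x1 ** p ** y1 = q -> x1 ** p ** y2 = 0 ->
    x2 ** p ** y1 = 0 -> x2 ** p ** y2 = q ->
  absorbs p q.
Proof.
move=> su [_ pi] qq h11 h12 h21 h22.
apply: (absorbs_idem su qq _ (esym h11)).
pose b := p ** y1 ** q ** (x1 ** p) + p ** y2 ** q ** (x2 ** p).
have /pi/precsim1P[u [w bE]] : in_RaR q b.
  exists 2%N, (fun i => if i == ord0 then p ** y1 else p ** y2),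
    (fun i => if i == ord0 then x1 ** p else x2 ** p).
  by rewrite big_ord_recl big_ord1.
have E x y : x ** u ** q ** (w ** y) = x ** b ** y by rewrite bE !nmulA.
have F x y c d c' d' : x ** p ** y1 = c -> x ** p ** y2 = c' ->
    x1 ** p ** y = d -> x2 ** p ** y = d' ->
    x ** b ** y = c ** q ** d + c' ** q ** d'.
  by move=> <- <- <- <-; rewrite /b nmulDr nmulDl !nmulA.
(* As [b = u ** q ** w], these witnesses compress [q] to the four corners of [b], which are [q] on
   the diagonal and zero off it. *)
exists (x1 ** u), (x2 ** u), (w ** y1), (w ** y2); rewrite !E.
rewrite (F _ _ _ _ _ _ h11 h12 h11 h21) (F _ _ _ _ _ _ h11 h12 h12 h22).
rewrite (F _ _ _ _ _ _ h21 h22 h11 h21) (F _ _ _ _ _ _ h21 h22 h12 h22).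
by rewrite !(nmul0l, nmul0r, addr0, add0r, qq).
Qed.

End PurelyInfinite.

(** * Quotients by the kernel of a character *)

Section Character.
Variables (K : fieldType) (R : nuAlgType K) (c : R -> K).
Hypothesis cD : forall x y, c (x + y) = c x + c y.
Hypothesis cM : forall x y, c (x ** y) = c x * c y.
Hypothesis cZ : forall a x, c (a *: x) = a * c x.

Definition char_ker : {pred R} := [pred x | c x == 0].

Let c0 : c 0 = 0.
Proof. by apply: (addIr (c 0)); rewrite -cD !add0r. Qed.

Let cN x : c (- x) = - c x.
Proof. by apply/eqP; rewrite -addr_eq0 -cD addNr c0. Qed.

Lemma char_ker_zmod : zmod_closed char_ker.
Proof.
split=> [|x y]; rewrite !inE ?c0 // => /eqP x0 /eqP y0.
by rewrite cD cN x0 y0 subrr.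
Qed.

Lemma char_ker_ideal (x y : R) : y \in char_ker ->
  (x ** y \in char_ker) && (y ** x \in char_ker).
Proof. by rewrite !inE !cM => /eqP ->; rewrite mulr0 mul0r eqxx. Qed.

HB.instance Definition _ := GRing.isZmodClosed.Build R char_ker char_ker_zmod.
HB.instance Definition _ := isNuIdeal.Build R char_ker char_ker_ideal.

(** The quotient by the kernel is a copy of [K]: [e] becomes its identity and [(c x)^-1 *: e]
    inverts the class of [x]. *)
Lemma char_not_purely_infinite (e : R) : c e = 1 -> ~ purely_infinite R.
Proof.
move=> ce [+ _] => /(_ char_ker); apply.
have pE (x y : R) : nuproj char_ker x = nuproj char_ker y <-> c x = c y.
  rewrite nuprojE inE cD cN subr_eq0.
  by split=> /eqP.
have p0 : nuproj char_ker 0 = 0.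
  by apply: (addIr (nuproj char_ker 0)); rewrite nuprojD !add0r.
exists (nuproj char_ker e); split.
- by apply/eqP; rewrite -p0 => /pE/eqP; rewrite c0 ce oner_eq0.
- move=> z; have [x <-] := nuproj_surj z.
  by split; apply: etrans (nuprojM _ _ _) _; apply/pE; rewrite cM ce ?mul1r ?mulr1.
- move=> z; have [x <-] := nuproj_surj z; rewrite -p0 => /eqP x0.
  have {}x0 : c x != 0 by apply/eqP => cx; apply: x0; apply/pE; rewrite cx c0.
  exists (nuproj char_ker ((c x)^-1 *: e)).
  by split; apply: etrans (nuprojM _ _ _) _; apply/pE;
    rewrite cM cZ ce mulr1 ?mulfV ?mulVf.
Qed.

End Character.

(** * The Kumjian-Pask algebra *)


Section KPAlgebra.
Variables (K : fieldType) (k : nat) (L : kgraph k).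
Implicit Types (a b l : kpath L) (v w : kvert L) (n : degree k) (x y : KP K L).

Local Notation s l := (kps K l).
Local Notation t l := (kpt K l).
Local Notation sv v := (kps K (kid v)).

Lemma kpsvM v w : sv v ** sv w = if v == w then sv v else 0.
Proof. by case: (KP_familyP K L). Qed.

Lemma kps_idem v : sv v ** sv v = sv v.
Proof. by rewrite kpsvM eqxx. Qed.

Lemma kpt_id v : t (kid v) = sv v.
Proof. by case: (KP_familyP K L). Qed.

Lemma kpsM a b : ksource a = krange b -> s a ** s b = s (kcat a b).
Proof.
by move=> e; rewrite kcatE; case: (KP_familyP K L) => _ _ /(_ _ _ e)[].
Qed.

Lemma kptM a b : ksource a = krange b -> t b ** t a = t (kcat a b).
Proof.
by move=> e; rewrite kcatE; case: (KP_familyP K L) => _ _ /(_ _ _ e)[].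
Qed.

Lemma kps_source v a : v = ksource a -> s a ** sv v = s a.
Proof. by move=> e; rewrite kpsM ?krange_id ?kcat1r. Qed.

Lemma kps_range v a : v = krange a -> sv v ** s a = s a.
Proof. by move=> e; rewrite kpsM ?ksource_id ?kcat1l. Qed.

Lemma kpt_source v a : v = ksource a -> sv v ** t a = t a.
Proof. by move=> e; rewrite -kpt_id kptM ?krange_id ?kcat1r. Qed.

Lemma kpt_range v a : v = krange a -> t a ** sv v = t a.
Proof. by move=> e; rewrite -kpt_id kptM ?ksource_id ?kcat1l. Qed.

Lemma kpt_kps n a b : Lle n a -> Lle n b ->
  t a ** s b = if a == b then sv (ksource a) else 0.
Proof. by case: (KP_familyP K L) => _ _ _ h _; exact: h. Qed.

Lemma kpt_kps_same a : t a ** s a = sv (ksource a).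
Proof. by rewrite (kpt_kps (Lle_deg a) (Lle_deg a)) eqxx. Qed.

Lemma kps_sum v n E : uniq E -> (forall l, l \in E <-> vLle v n l) ->
  sv v = \sum_(l <- E) s l ** t l.
Proof. by case: (KP_familyP K L) => _ _ _ _ h; exact: h. Qed.

Lemma kps_ortho a b : ksource a <> krange b -> s a ** s b = 0.
Proof.
move=> ab; rewrite -(kps_source (erefl (ksource a))).
rewrite -(kps_range (erefl (krange b))) -nmulA (nmulA (sv _)) kpsvM.
by case: eqP => // _; rewrite nmul0l nmul0r.
Qed.

Lemma KP_ind (P : KP K L -> Prop) :
  (forall a, P (s a)) -> (forall a, P (t a)) -> P 0 ->
  (forall x y, P x -> P y -> P (x + y)) ->
  (forall c x, P x -> P (c *: x)) ->
  (forall x y, P x -> P y -> P (x ** y)) -> forall x, P x.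
Proof.
move=> hs ht h0 hD hZ hM x; have [u <-] := kpcl_surj x.
elim: u => [a|a||u IH|u IH u' IH'|c u IH|u IH u' IH'].
- exact: hs.
- exact: ht.
- exact: h0.
- by rewrite kpcl_opp -scaleN1r; exact: hZ.
- by rewrite kpcl_add; exact: hD.
- by rewrite kpcl_scale; exact: hZ.
- by rewrite kpcl_mul; exact: hM.
Qed.

Definition svsum (F : seq (kvert L)) : KP K L := \sum_(v <- F) sv v.

Lemma svsum_l F v x : uniq F -> v \in F -> sv v ** x = x -> svsum F ** x = x.
Proof.
move=> uF vF xE; rewrite /svsum nmul_suml (bigD1_seq v) //= xE.
rewrite big1_seq ?addr0 // => w /andP[wv _].
by rewrite -xE nmulA kpsvM (negbTE wv) nmul0l.
Qed.

Lemma svsum_r F v x : uniq F -> v \in F -> x ** sv v = x -> x ** svsum F = x.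
Proof.
move=> uF vF xE; rewrite /svsum nmul_sumr (bigD1_seq v) //= xE.
rewrite big1_seq ?addr0 // => w /andP[wv _].
by rewrite -xE -nmulA kpsvM eq_sym (negbTE wv) nmul0r.
Qed.

(** Allowing every larger finite vertex set lets the units of two elements be merged in sums and
    products. *)
Lemma KP_local_unit x : exists F0 : seq (kvert L), forall F, uniq F -> {subset F0 <= F} ->
  svsum F ** x = x /\ x ** svsum F = x.
Proof.
elim/KP_ind: x => [a|a||x y [F h] [F' h']|c x [F h]|x y [F h] [F' h']].
- exists [:: krange a; ksource a] => F uF sF; split.
    by apply: (@svsum_l _ (krange a)); rewrite ?kps_range ?sF ?inE ?eqxx.
  by apply: (@svsum_r _ (ksource a)); rewrite ?kps_source ?sF ?inE ?eqxx ?orbT.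
- exists [:: krange a; ksource a] => F uF sF; split.
    by apply: (@svsum_l _ (ksource a)); rewrite ?kpt_source ?sF ?inE ?eqxx ?orbT.
  by apply: (@svsum_r _ (krange a)); rewrite ?kpt_range ?sF ?inE ?eqxx.
- by exists [::] => F _ _; rewrite nmul0l nmul0r.
- exists (F ++ F') => G uG sG.
  have [|h1 h2] := h G uG; first by move=> v vF; rewrite sG // mem_cat vF.
  have [|h3 h4] := h' G uG; first by move=> v vF; rewrite sG // mem_cat vF orbT.
  by rewrite nmulDl nmulDr h1 h2 h3 h4.
- exists F => G uG sG; have [h1 h2] := h G uG sG.
  by rewrite -nscaleAl -nscaleAr h1 h2.
- exists (F ++ F') => G uG sG.
  have [|h1 h2] := h G uG; first by move=> v vF; rewrite sG // mem_cat vF.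
  have [|h3 h4] := h' G uG; first by move=> v vF; rewrite sG // mem_cat vF orbT.
  by rewrite nmulA h1 -nmulA h4.
Qed.

Lemma KP_s_unital : s_unital (KP K L).
Proof.
move=> x; have [F h] := KP_local_unit x.
by have [|h1 h2] := h _ (undup_uniq F);
  [move=> v; rewrite mem_undup | exists (svsum (undup F))].
Qed.

Inductive gspan (Q : kpath L -> Prop) : KP K L -> Prop :=
  | gspan_gen a : Q a -> gspan Q (s a)
  | gspan0 : gspan Q 0
  | gspanD x y : gspan Q x -> gspan Q y -> gspan Q (x + y)
  | gspanZ c x : gspan Q x -> gspan Q (c *: x).

Lemma gspan_sum Q (E : seq (kpath L)) F :
  (forall l, l \in E -> gspan Q (F l)) -> gspan Q (\sum_(l <- E) F l).
Proof.
move=> h; rewrite big_seq; apply: big_ind => //; first exact: gspan0.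
exact: gspanD.
Qed.

Lemma gspan_mul Q Q' x y : gspan Q y ->
  (forall a, Q a -> gspan Q' (x ** s a)) -> gspan Q' (x ** y).
Proof.
move=> Qy h; elim: Qy => [a Qa||u u' _ h1 _ h2|c u _ h1]; first exact: h.
- by rewrite nmul0r; exact: gspan0.
- by rewrite nmulDr; exact: gspanD.
- by rewrite -nscaleAr; exact: gspanZ.
Qed.

Lemma gspan_coef Q x : gspan Q x -> exists (E : seq (kpath L)) c,
  [/\ uniq E, forall l, l \in E -> Q l & x = \sum_(l <- E) c l *: s l].
Proof.
elim=> [a Qa||u u' _ [E [c [uE QE ->]]] _ [E' [c' [uE' QE' ->]]]|d u _
    [E [c [uE QE ->]]]].
- exists [:: a], (fun _ => 1); split=> // [l|]; first by rewrite inE => /eqP ->.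
  by rewrite big_seq1 scale1r.
- by exists [::], (fun _ => 0); rewrite big_nil.
(* Padding with zero coefficients brings both combinations over one common list. *)
- have ext (G G' : seq (kpath L)) (d : kpath L -> K) : uniq G -> uniq G' -> {subset G <= G'} ->
    \sum_(l <- G) d l *: s l = \sum_(l <- G') (if l \in G then d l else 0) *: s l.
    move=> uG uG' GG'.
    rewrite [RHS](bigID (fun l => l \in G)) /= [X in _ = _ + X]big1 ?addr0; last first.
      by move=> l /negbTE ->; rewrite scale0r.
    rewrite [RHS](eq_bigr (fun l => d l *: s l)); last by move=> l ->.
    rewrite -[RHS]big_filter; apply/perm_big/uniq_perm => // [|l].
      exact: filter_uniq.
    by rewrite mem_filter; case: (boolP (l \in G)) => //= /GG' ->.
  exists (undup (E ++ E')), (fun l => (if l \in E then c l else 0) +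
    (if l \in E' then c' l else 0)); split.
  + exact: undup_uniq.
  + by move=> l; rewrite mem_undup mem_cat => /orP[/QE|/QE'].
  + have uG := undup_uniq (E ++ E').
    rewrite (ext E _ c uE uG) ?(ext E' _ c' uE' uG).
    * by rewrite -big_split /=; apply: eq_bigr => l _; rewrite scalerDl.
    * by move=> l; rewrite mem_undup mem_cat => ->; rewrite orbT.
    * by move=> l; rewrite mem_undup mem_cat => ->.
- exists E, (fun l => d * c l); split=> //.
  by rewrite scaler_sumr; apply: eq_bigr => l _; rewrite scalerA.
Qed.

Section RowFinite.
Hypothesis rf : row_finite L.

(* Multiplying by [s_g] removes the ghost generators as soon as [g] is maximal
   below a large enough degree; the lower bound [m] makes this multiplicative. *)
Lemma KP_mul_gen x m : exists n0, forall n g, dle n0 n -> Lle n g ->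
  gspan (fun l => ksource l = ksource g /\ exists2 n', dle m n' & Lle n' l)
    (x ** s g).
Proof.
elim/KP_ind: x m => [a|a||x y h h'|c x h|x y h h'] m.
- exists m => n g mn gn; have [ag|ag] := pselect (ksource a = krange g).
    rewrite kpsM //; apply: gspan_gen; split; first by rewrite ksource_cat.
    exists (kdeg a + n); last exact: Lle_cat.
    by apply: dle_trans mn _; rewrite addrC dle_addr.
  by rewrite kps_ortho //; exact: gspan0.
- exists (kdeg a + m) => n g amn gn.
  have an : dle (kdeg a) n := dle_trans (dle_addr _ _) amn.
  have mn : dle m (dsub n (kdeg a)).
    by rewrite -(dle_add2l (kdeg a)) dsubK.
  have [E uE EP] := Lle_list rf (ksource a) (dsub n (kdeg a)).
  (* (KP4) at [ksource a] in degree [n - d(a)] writes [t_a] as a sum of [s_l t_{al}]. Each [al] and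
     [g] lie in [Lle n], so (KP3) removes the ghost part. *)
  rewrite -(kpt_source (erefl (ksource a))) (kps_sum uE EP) !nmul_suml.
  apply: gspan_sum => l /EP[lr ln].
  rewrite -(nmulA (s l)) kptM // -nmulA.
  rewrite (kpt_kps _ gn); last exact: Lle_cat_sub.
  case: eqP => [<-|_]; last by rewrite nmul0r; exact: gspan0.
  rewrite ksource_cat // kps_source //; apply: gspan_gen; split=> //.
  by exists (dsub n (kdeg a)).
- by exists 0 => n g _ _; rewrite nmul0l; exact: gspan0.
- have [n0 hn] := h m; have [n0' hn'] := h' m.
  exists (djoin n0 n0') => n g jn gn; rewrite nmulDl; apply: gspanD.
    by apply: (hn n) => //; exact: (dle_trans (dle_joinl _ _) jn).
  by apply: (hn' n) => //; exact: (dle_trans (dle_joinr _ _) jn).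
- have [n0 hn] := h m; exists n0 => n g gn lg.
  by rewrite -nscaleAl; apply: gspanZ; exact: (hn n).
(* The right factor is asked to produce paths maximal below degrees at least [n0], the range in
   which the left factor is controlled. *)
- have [n0 hn] := h m; have [n1 hn1] := h' n0.
  exists n1 => n g gn lg; rewrite -nmulA; apply: gspan_mul; first exact: (hn1 n).
  by move=> l [<- [n' n0n' ln']]; exact: (hn n').
Qed.

Section Ideal.
Variable I : KP K L -> Prop.
Hypothesis idI : is_ideal I.

Let I0 : I 0. Proof. by case: idI. Qed.
Let ID x y : I x -> I y -> I (x + y). Proof. by case: idI => _ h _; exact: h. Qed.
Let IM x r u : I x -> I (r ** x ** u). Proof. by case: idI => _ _ h; exact: h. Qed.

Lemma ideal_mulr x u : I x -> I (x ** u).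
Proof. by move=> Ix; have [e ex _] := KP_s_unital x; rewrite -ex; exact: IM. Qed.

Lemma ideal_mull x r : I x -> I (r ** x).
Proof.
move=> Ix; have [e _ xe] := KP_s_unital x.
by rewrite -[in r ** x]xe nmulA; exact: IM.
Qed.

Lemma ideal_scale c x : I x -> I (c *: x).
Proof.
by move=> Ix; have [e ex _] := KP_s_unital x; rewrite -ex nscaleAl; exact: ideal_mull.
Qed.

Lemma ideal_sum (T : eqType) (E : seq T) F :
  (forall i, i \in E -> I (F i)) -> I (\sum_(i <- E) F i).
Proof. by move=> h; rewrite big_seq; apply: big_ind. Qed.

Definition ivert : set (kvert L) := [set v | I (sv v)].

(** The source projection of [l] equals [t_l s_{r(l)} s_l]. *)
Lemma ivert_hereditary : hereditary ivert.
Proof.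
move=> l Il; rewrite /ivert /= -kpt_kps_same -(kps_range (erefl (krange l))) nmulA.
exact: IM.
Qed.

Lemma ideal_kps l : ivert (ksource l) -> I (s l).
Proof. by move=> Il; rewrite -(kps_source (erefl (ksource l))); exact: ideal_mull. Qed.

Lemma ivert_saturated : saturated ivert.
Proof.
move=> v n h; have [E uE EP] := Lle_list rf v n.
rewrite /ivert /= (kps_sum uE EP); apply: ideal_sum => l /EP lE.
by apply/ideal_mulr/ideal_kps/h; exists l.
Qed.

(* [t_a s_b] is a combination of the [s_c t_d] with [ac = bd]. *)
Lemma ideal_kpt_kps a b :
  (forall c d, ksource a = krange c -> ksource b = krange d ->
     kcat a c = kcat b d -> ivert (ksource c)) -> I (t a ** s b).
Proof.
(* The degrees are exchanged so that [ac] and [bd] both lie in [Lle (kdeg a + kdeg b)], where (KP3)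
   compares them. *)
move=> h; have [E uE EP] := Lle_list rf (ksource a) (kdeg b).
have [G uG GP] := Lle_list rf (ksource b) (kdeg a).
rewrite -(kpt_source (erefl (ksource a))) -(kps_source (erefl (ksource b))).
rewrite (kps_sum uE EP) (kps_sum uG GP) nmul_suml nmul_suml.
apply: ideal_sum => c /EP[cr cn]; rewrite nmul_sumr nmul_sumr.
apply: ideal_sum => d /GP[dr dn].
have -> : s c ** t c ** t a ** (s b ** (s d ** t d)) =
    s c ** ((t c ** t a) ** (s b ** s d)) ** t d by rewrite !nmulA.
rewrite kptM // kpsM //; apply: IM.
rewrite (@kpt_kps (kdeg a + kdeg b)); [|exact: Lle_cat|]; last first.
  by rewrite addrC; exact: Lle_cat.
by case: eqP => // /h; rewrite ksource_cat //; exact.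
Qed.

(** If [x ** s g] lay in [I] for every [g] in [Lle n], expanding a local unit of [x] by (KP4) would
    put [x] in [I]. For large [n] such a product has no ghost part. *)
Lemma ideal_complement x : ~ I x -> exists v (E : seq (kpath L)) c,
  [/\ ~ ivert v, uniq E, forall l, l \in E -> ksource l = v &
    exists2 y, x ** y = \sum_(l <- E) c l *: s l & ~ I (x ** y)].
Proof.
move=> Ix; have [F hF] := KP_local_unit x.
have [|_ xF] := hF _ (undup_uniq F); first by move=> v; rewrite mem_undup.
have [n hn] := KP_mul_gen x 0.
have [[g [gn Ig]]|Ig] := pselect (exists g, Lle n g /\ ~ I (x ** s g)).
  have /gspan_coef[E [c [uE EP xE]]] := hn n g (dle_refl n) gn.
  exists (ksource g), E, c; split=> //; last 1 first.
  - by exists (s g).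
  - by move=> /ideal_kps/ideal_mull.
  - by move=> l /EP[].
case: Ix; rewrite -xF /svsum nmul_sumr; apply: ideal_sum => v _.
have [E uE EP] := Lle_list rf v n.
rewrite (kps_sum uE EP) nmul_sumr; apply: ideal_sum => g /EP[_ gn].
by rewrite nmulA; apply: ideal_mulr; apply: contrapT => h; case: Ig; exists g.
Qed.

End Ideal.
End RowFinite.
End KPAlgebra.

(** * Aperiodicity *)


Section Aperiodic.
Variables (k : nat) (L : kgraph k).
Implicit Types (a b c d l : kpath L) (v w : kvert L).

Definition isegment (x : ipath L) t (h : xle t (ideg x)) : kpath L :=
  x (omp (dle0 t) h).

Lemma kdeg_isegment x t (h : xle t (ideg x)) : kdeg (isegment h) = t.
Proof. by rewrite /isegment mdeg; apply/ffunP => i; rewrite !ffunE subn0. Qed.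

Lemma krange_isegment x t (h : xle t (ideg x)) :
  krange (isegment h) = irange x.
Proof. by rewrite mrange; congr (mvert x); exact: val_inj. Qed.

Lemma ksource_isegment x t (h : xle t (ideg x)) :
  ksource (isegment h) = mvert x (omv h).
Proof. by rewrite msource; congr (mvert x); exact: val_inj. Qed.

Lemma isegment_prefix x t t' (h : xle t (ideg x)) (h' : xle t' (ideg x)) :
  dle t t' -> kprefix (isegment h) (isegment h').
Proof.
move=> tt'.
have oe : @ksource k (Omega (ideg x)) (omp (dle0 t) h) = krange (omp tt' h').
  exact: val_inj.
have xe : ksource (isegment h) = krange (x (omp tt' h')).
  by rewrite msource mrange oe.
exists (x (omp tt' h')) => //; rewrite kcatE -(mcomp oe).
by congr (mpath x); exact: val_inj.
Qed.

(** Finite counterpart of the inequality of concatenations in aperiodicity. *)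
Definition separates l a b := forall c d,
  ksource l = krange c -> ksource l = krange d ->
  kcat (kcat a l) c <> kcat (kcat b l) d.

Lemma separates_prefix l l' a b : ksource a = krange l -> ksource b = krange l ->
  kprefix l l' -> separates l a b -> separates l' a b.
Proof.
move=> al bl [e le ->] sep c d; rewrite ksource_cat // => ec ed.
rewrite -(kcatA al) // -(kcatA bl) // (kcatA _ ec) ?ksource_cat //.
by rewrite (kcatA _ ed) ?ksource_cat //; apply: sep; rewrite krange_cat.
Qed.

(** If no segment of [x] separates, then for each segment the two prolonged paths have a common
    extension, and this forces equal degrees and equal initial segments of the two
    concatenations. *)
Lemma concat_separates (x : ipath L) a b (ax : ksource a = irange x)
    (bx : ksource b = irange x) : is_boundary x -> concat ax <> concat bx ->
  exists t (h : xle t (ideg x)), separates (isegment h) a b.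
Proof.
move=> xb ab; apply: contrapT => nosep; apply: ab.
have common t (h : xle t (ideg x)) : exists c d,
    [/\ ksource (isegment h) = krange c, ksource (isegment h) = krange d &
      kcat (kcat a (isegment h)) c = kcat (kcat b (isegment h)) d].
  apply: contrapT => hn; apply: nosep; exists t, h => c d hc hd E.
  by apply: hn; exists c, d.
have aseg t (h : xle t (ideg x)) : ksource a = krange (isegment h).
  by rewrite krange_isegment.
have bseg t (h : xle t (ideg x)) : ksource b = krange (isegment h).
  by rewrite krange_isegment.
(* Where [x] ends in direction [i], the boundary condition forbids adding edges of colour [i], so
   the common extension compares the degrees of [a] and [b] there. *)
have degE i n : ideg x i = Some n -> kdeg a i = kdeg b i.
  move=> xi; pose t : degree k := [ffun j => if j == i then n else 0%N].
  have ti : t i = n by rewrite ffunE eqxx.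
  have h : xle t (ideg x).
    by apply/xleP => j m; rewrite ffunE; case: eqP => // ->; rewrite xi => -[->].
  have [c [d [hc hd E]]] := common t h.
  have ne : ~ (vLn (ksource (isegment h)) (dbase i) !=set0).
    by rewrite ksource_isegment (xb _ h i) ?ti // => -[].
  have : kdeg (kcat (kcat a (isegment h)) c) i
      = kdeg (kcat (kcat b (isegment h)) d) i by rewrite E.
  rewrite (@kcat_neq_deg0 _ _ _ c) ?ksource_cat //.
  rewrite (@kcat_neq_deg0 _ _ _ d) ?ksource_cat //.
  rewrite !kdeg_cat // kdeg_isegment !daddE ti.
  by move/eqP; rewrite eqn_add2r => /eqP.
have ideg_ab : ideg (concat ax) = ideg (concat bx).
  apply/ffunP => i; rewrite !ffunE; case E : (ideg x i) => [n|//] /=.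
  by rewrite (degE i n E).
apply: (ipath_eq ideg_ab) => p q pq qa qb.
rewrite /= /coh_path /=; congr ktail.
move: (om_source_subproof _) (om_source_subproof _) => /= hb ha.
rewrite /concat_init.
(* This segment of [x] is long enough to determine both concatenations up to degree [q]. *)
pose t := djoin (dsub q (kdeg a)) (dsub q (kdeg b)).
have h : xle t (ideg x).
  apply/xleP => i n xi; rewrite ffunE geq_max.
  have /xleP/(_ _ _ xi) -> := concat_bound ha.
  by have /xleP/(_ _ _ xi) -> := concat_bound hb.
rewrite -(concat_grow ax (concat_bound ha) h (dle_joinl _ _) (dle_concat _ _)).
rewrite -(concat_grow bx (concat_bound hb) h (dle_joinr _ _) (dle_concat _ _)).
rewrite -!kcatE.
have [c [d [hc hd E]]] := common t h.
have qa' : dle q (kdeg (kcat a (isegment h))).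
  rewrite kdeg_cat // kdeg_isegment; apply: dle_trans (dle_concat a q) _.
  by rewrite dle_add2l dle_joinl.
have qb' : dle q (kdeg (kcat b (isegment h))).
  rewrite kdeg_cat // kdeg_isegment; apply: dle_trans (dle_concat b q) _.
  by rewrite dle_add2l dle_joinr.
transitivity (kinit (kcat (kcat a (isegment h)) c) q).
  by rewrite [RHS]kinit_catl ?ksource_cat.
by rewrite E [LHS]kinit_catl ?ksource_cat.
Qed.

(** One boundary path [x] separates each of the finitely many pairs along some segment; separation
    persists along longer segments, so a join of degrees serves all pairs. *)
Lemma aperiodic_separates : aperiodic L -> forall v (E : seq (kpath L)),
    (forall a, a \in E -> ksource a = v) ->
  exists2 l, krange l = v &
    forall a b, a \in E -> b \in E -> a <> b -> separates l a b.
Proof.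
move=> ap v E Ev; have [x [xb [xv hx]]] := ap v.
suff [t [h sep]] : exists t (h : xle t (ideg x)), forall a b,
    a \in E -> b \in E -> a <> b -> separates (isegment h) a b.
  by exists (isegment h) => //; rewrite krange_isegment.
suff [t [h sep]] : exists t (h : xle t (ideg x)), forall ab,
    ab \in [seq (a, b) | a <- E, b <- E] -> ab.1 <> ab.2 ->
    separates (isegment h) ab.1 ab.2.
  exists t, h => a b aE bE; apply: (sep (a, b)).
  by apply/allpairsP; exists (a, b).
have : forall ab, ab \in [seq (a, b) | a <- E, b <- E] ->
    ksource ab.1 = v /\ ksource ab.2 = v.
  by move=> _ /allpairsP[[a b] [/= aE bE ->]]; rewrite !Ev.
elim: [seq (a, b) | a <- E, b <- E] => [_|[a b] G IH hG].
  by exists 0, (xle0 _).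
have hG' ab : ab \in G -> ksource ab.1 = v /\ ksource ab.2 = v.
  by move=> abG; apply: hG; rewrite inE abG orbT.
have [t [h sep]] := IH hG'.
have [/= av bv] := hG _ (mem_head _ _).
have [<-|ab] := pselect (a = b).
  by exists t, h => ab; rewrite inE => /orP[/eqP -> //|]; exact: sep.
have [t' [h' sep']] := concat_separates xb (hx a b av bv ab).
have h2 : xle (djoin t t') (ideg x).
  apply/xleP => i n xi; rewrite ffunE geq_max.
  by move/xleP: (h) => -> //; move/xleP: (h') => ->.
exists (djoin t t'), h2 => ab'; rewrite inE => /orP[/eqP -> _ /=|abG ne].
  apply: separates_prefix sep'; rewrite ?krange_isegment ?xv //.
  exact/isegment_prefix/dle_joinr.
have [v1 v2] := hG' ab' abG.
apply: separates_prefix (sep ab' abG ne); rewrite ?krange_isegment ?xv //.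
exact/isegment_prefix/dle_joinl.
Qed.

End Aperiodic.

Section Minus.
Variables (k : nat) (L : kgraph k) (H : set (kvert L)) (hH : hereditary H).
Implicit Types (a b c l : kpath L).

Lemma val_kcat (a b : kpath (kminus hH)) : ksource a = krange b ->
  val (kcat a b) = kcat (val a) (val b).
Proof. by move=> e; rewrite kcatE (kcatE (congr1 val e)). Qed.

(** A common extension whose source is outside [H] would already live in the smaller graph, where
    separation excludes it. *)
Lemma kminus_separates : aperiodic (kminus hH) -> forall v (E : seq (kpath L)),
    ~ H v -> (forall a, a \in E -> ksource a = v) ->
  exists l, [/\ krange l = v, ~ H (ksource l) &
    forall a b, a \in E -> b \in E -> a <> b -> forall c d,
      ksource l = krange c -> ksource l = krange d ->
      kcat (kcat a l) c = kcat (kcat b l) d -> H (ksource c)].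
Proof.
move=> ap v E Hv Ev.
have nH w : ~ H w -> w \notin H by move=> Hw; apply/negP => /set_mem.
have lift_ext : forall (F : seq (kpath L)), (forall a, a \in F -> ksource a = v) ->
    exists2 F' : seq (kpath (kminus hH)), F = map val F' &
      forall a : kpath (kminus hH), a \in F' -> val (ksource a) = v.
  elim=> [|a F IH] Fv; first by exists [::].
  have [|F' -> F'v] := IH.
    by move=> b bF; apply: Fv; rewrite inE bF orbT.
  have av := Fv a (mem_head _ _).
  have ha : ksource a \notin H by rewrite av nH.
  exists (exist _ a ha :: F') => // b; rewrite inE => /orP[/eqP ->|/F'v //].
  exact: av.
have [E' EE E'v] := lift_ext E Ev.
pose v' : kvert (kminus hH) := exist _ v (nH _ Hv).
have [|l lv sep] := aperiodic_separates ap (v := v') (E := E').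
  by move=> a /E'v av; apply: val_inj.
exists (val l); split.
- exact: (congr1 val lv).
- by move: (valP l) => + h; rewrite (mem_set h).
rewrite EE => _ _ /mapP[a aE ->] /mapP[b bE ->] ab c d lc ld E2.
apply: contrapT => /nH hc.
have lc' : ksource l = @krange k (kminus hH) (exist _ c hc) by exact: val_inj.
have al : @ksource k (kminus hH) a = krange l by rewrite lv; apply: val_inj; exact: E'v.
have bl : @ksource k (kminus hH) b = krange l by rewrite lv; apply: val_inj; exact: E'v.
have hd : ksource d \notin H.
  have alv := congr1 val al; have blv := congr1 val bl.
  by have := congr1 ksource E2; rewrite !ksource_cat // => <-.
have ld' : ksource l = @krange k (kminus hH) (exist _ d hd) by exact: val_inj.
apply: (sep a b aE bE _ (exist _ c hc) (exist _ d hd) lc' ld').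
  by move=> ab'; apply: ab; rewrite ab'.
by apply: val_inj; rewrite !val_kcat ?ksource_cat.
Qed.

End Minus.


(** * Compression to a vertex modulo an ideal *)

Section Reduction.
Variables (K : fieldType) (k : nat) (L : kgraph k).
Hypothesis rf : row_finite L.
Hypothesis sa : strongly_aperiodic L.
Implicit Types (v w : kvert L) (x y z : KP K L).

Local Notation s l := (kps K l).
Local Notation t l := (kpt K l).
Local Notation sv v := (kps K (kid v)).

(** Sandwich a ghost-free multiple of [x] between [t_{a0 l}] and [s_l]. The [a0] term gives a
    nonzero multiple of the projection at [ksource l]. For the other [a], common extensions of
    [a0 l] and [a l] end at vertices of the ideal, so these terms lie in [I]. *)
Lemma vertex_mod_ideal (I : KP K L -> Prop) x : is_ideal I -> ~ I x ->
  exists w y z u, [/\ ~ I (sv w), I u & sv w = y ** x ** z + u].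
Proof.
move=> idI Ix.
have [v [E [c [Hv uE Ev [y xy nI]]]]] := ideal_complement rf idI Ix.
have [l [lv Hl sep]] :=
  kminus_separates (@sa _ (ivert_hereditary idI) (ivert_saturated rf idI)) Hv Ev.
have [a0 a0E ca0] : exists2 a, a \in E & c a != 0.
  apply: contrapT => hc; apply: nI; rewrite xy big1_seq; first by case: idI.
  move=> a /andP[_ aE]; case: (eqVneq (c a) 0) => [->|ca]; first by rewrite scale0r.
  by case: hc; exists a.
have El a : a \in E -> ksource a = krange l by move=> /Ev ->.
pose a1 := kcat a0 l.
pose rest : KP K L := \sum_(a <- E | a != a0) c a *: (t a1 ** s (kcat a l)).
have E1 : t a1 ** (x ** y) ** s l = c a0 *: sv (ksource l) + rest.
  rewrite xy nmul_sumr nmul_suml (bigD1_seq a0) //=; congr (_ + _).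
    rewrite -nscaleAr -nscaleAl -nmulA kpsM ?(El _ a0E) // -/a1 kpt_kps_same.
    by rewrite ksource_cat ?(El _ a0E).
  rewrite big_seq_cond [RHS]big_seq_cond; apply: eq_bigr => a /andP[aE _].
  by rewrite -nscaleAr -nscaleAl -nmulA kpsM ?(El _ aE).
exists (ksource l), ((c a0)^-1 *: t a1), (y ** s l), (- (c a0)^-1 *: rest).
split=> //.
  apply: (ideal_scale idI).
  rewrite /rest -big_filter; apply: (ideal_sum idI) => a.
  rewrite mem_filter => /andP[/eqP aa0 aE]; apply/(ideal_scale idI)/(ideal_kpt_kps rf idI) => d e.
  rewrite /a1 !ksource_cat ?(El _ a0E) ?(El _ aE) // => ld le.
  by apply: (sep a0 a a0E aE _ d e ld le) => a0a; apply: aa0.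
rewrite -!nscaleAl scaleNr -scalerBr nmulA -(nmulA (t a1)) E1 addrK scalerA mulVf //.
by rewrite scale1r.
Qed.

Lemma properly_infinite_vertices :
  (forall v, properly_infinite (sv v)) -> properly_purely_infinite (KP K L).
Proof.
move=> pv a a0; apply/properly_infiniteP; split=> //; apply: contrapT => na.
have su := @KP_s_unital K k L.
have [w [y [z [u [Iw Iu wE]]]]] := vertex_mod_ideal (absorbs_ideal su a) na.
apply: Iw; have [y' [z' wE']] := absorbs_add_below Iu wE.
apply: absorbs_idem wE' => //; first exact: kps_idem.
by have /properly_infiniteP[] := pv w.
Qed.

End Reduction.

(** * Boundary paths and representations *)


Section BoundaryFilters.
Variables (k : nat) (L : kgraph k).
Hypothesis lc : locally_convex L.
Implicit Types (a b c l : kpath L) (v : kvert L) (n : degree k).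
Implicit Types P : set (kpath L).

(* A boundary path, represented by the set of its finite initial segments. *)
Definition bfilter P :=
  [/\ forall a b, P a -> P b -> exists c, [/\ P c, kprefix a c & kprefix b c],
      forall a c, P c -> kprefix a c -> P a &
      forall n, exists2 a, P a & Lle n a].

Definition bshift l P : set (kpath L) :=
  [set a | ksource l = krange a /\ P (kcat l a)].

(** The closure under prefixes adds the segments of the concatenated path that do not pass through
    all of [l]. *)
Definition bcons l P : set (kpath L) :=
  [set c | exists b, [/\ P b, ksource l = krange b & kprefix c (kcat l b)]].

Section Filter.
Variable P : set (kpath L).
Hypothesis bP : bfilter P.

Lemma bfilter_join a b : P a -> P b ->
  exists c, [/\ P c, kprefix a c & kprefix b c].
Proof. by case: bP => h _ _; exact: h. Qed.

Lemma bfilter_prefix a c : P c -> kprefix a c -> P a.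
Proof. by case: bP => _ h _; exact: h. Qed.

Lemma bfilter_Lle n : exists2 a, P a & Lle n a.
Proof. by case: bP. Qed.

Lemma bfilter_range a b : P a -> P b -> krange a = krange b.
Proof.
move=> Pa Pb; have [c [_ ac bc]] := bfilter_join Pa Pb.
by rewrite -(kprefix_range ac) (kprefix_range bc).
Qed.

Lemma bfilter_id a : P a -> P (kid (krange a)).
Proof. by move=> Pa; apply: (bfilter_prefix Pa); exact: kprefix_id. Qed.

(** An identity path in [P] records the range of the boundary path; ranges are expressed this way
    below. *)
Lemma bfilter_id_range v a : P (kid v) -> P a -> v = krange a.
Proof. by move=> Pv Pa; rewrite -(bfilter_range Pv Pa) krange_id. Qed.

Lemma bfilter_join_cat l a : P l -> P a ->
  exists b, [/\ ksource l = krange b, P (kcat l b) & kprefix a (kcat l b)].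
Proof.
move=> Pl Pa; have [c [Pc [b lb cE] ac]] := bfilter_join Pl Pa.
by exists b; rewrite -cE.
Qed.

Lemma bfilter_shift l : P l -> bfilter (bshift l P).
Proof.
move=> Pl; split=> [a b [la Pa] [lb Pb]|a c [lc' Pc] ac|n].
- have [c [Pc [d]]] := bfilter_join Pa Pb; rewrite ksource_cat // => ad cE.
  have ld : ksource l = krange (kcat a d) by rewrite krange_cat.
  rewrite cE kcatA // => /(kprefix_cat2 lb ld) bad.
  by exists (kcat a d); split=> //; [split=> //; rewrite -kcatA // -cE|exists d].
- have la : ksource l = krange a by rewrite lc' (kprefix_range ac).
  by split=> //; apply: (bfilter_prefix Pc); exact: kcat_prefix.
(* A segment maximal below [kdeg l + n] must extend [l], and what follows [l] is maximal below
   [n]. *)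
- have [a Pa an] := bfilter_Lle (kdeg l + n).
  have [c [_ ac lc']] := bfilter_join Pa Pl.
  have [b lb E] := Lle_prefix an (dle_addr _ _) ac lc'.
  exists b; first by split=> //; rewrite -E.
  move: an; rewrite E => -[]; rewrite kdeg_cat // dle_add2l => bn bmax.
  by split=> // i; have := bmax i; rewrite -addrA dle_add2l ksource_cat.
Qed.

Lemma bcons_mem l a : P (kid (ksource l)) -> P a ->
  ksource l = krange a /\ bcons l P (kcat l a).
Proof.
move=> Pl Pa; have la := bfilter_id_range Pl Pa.
by split=> //; exists a; split=> //; exact: kprefix_refl.
Qed.

(** Local convexity enters through the third condition: [l] followed by a segment in [Lle n] must
    have a prefix in [Lle n]. *)
Lemma bfilter_cons l : P (kid (ksource l)) -> bfilter (bcons l P).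
Proof.
move=> Pl; split=> [a b [a' [Pa la aa']] [b' [Pb lb bb']]|a c [b [Pb lb cb]] ac|n].
- have [c [Pc ac bc]] := bfilter_join Pa Pb.
  exists (kcat l c); split; first by have [] := bcons_mem Pl Pc.
    exact: kprefix_trans aa' (kcat_prefix la ac).
  exact: kprefix_trans bb' (kcat_prefix lb bc).
- by exists b; split=> //; exact: kprefix_trans cb.
- have [b Pb bn] := bfilter_Lle n; have [lb _] := bcons_mem Pl Pb.
  have [a ab an] := Lle_kinit lc (dle_addl (kdeg l) n) (Lle_cat lb bn).
  by exists a => //; exists b.
Qed.

Lemma bshift_cons l : P (kid (ksource l)) -> bshift l (bcons l P) = P.
Proof.
move=> Pl; apply/seteqP; split=> [a [la [b [Pb lb /(kprefix_cat2 la lb) ab]]]|a Pa].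
  exact: bfilter_prefix Pb ab.
by have [] := bcons_mem Pl Pa.
Qed.

Lemma bcons_shift l : P l -> bcons l (bshift l P) = P.
Proof.
move=> Pl; apply/seteqP; split=> [c [b [[_ Pb] _ cb]]|c Pc].
  exact: bfilter_prefix Pb cb.
by have [b [lb Pb cb]] := bfilter_join_cat Pl Pc; exists b.
Qed.

Lemma bshift_id v : P (kid v) -> bshift (kid v) P = P.
Proof.
move=> Pv; apply/seteqP; split=> a; rewrite /bshift /= ksource_id.
  by move=> [va]; rewrite kcat1l.
by move=> Pa; have va := bfilter_id_range Pv Pa; rewrite kcat1l.
Qed.

Lemma bcons_id v : P (kid v) -> bcons (kid v) P = P.
Proof. by move=> Pv; rewrite -{1}(bshift_id Pv) bcons_shift. Qed.

Lemma bcons_cat a b : ksource a = krange b ->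
  bcons a (bcons b P) = bcons (kcat a b) P.
Proof.
move=> ab; apply/seteqP; split=> c.
  move=> [d [[e [Pe be de]] ad cd]]; exists e; split=> //.
    by rewrite ksource_cat.
  by rewrite kcatA //; exact: kprefix_trans cd (kcat_prefix ad de).
move=> [e [Pe]]; rewrite ksource_cat // => be ce.
exists (kcat b e); split; last by rewrite -kcatA.
  by exists e; split=> //; exact: kprefix_refl.
by rewrite krange_cat.
Qed.

Lemma bcons_self l : P (kid (ksource l)) -> bcons l P l.
Proof. by move=> Pl; have [_] := bcons_mem Pl Pl; rewrite kcat1r. Qed.

End Filter.

Lemma bshift_cat P a b : ksource a = krange b ->
  bshift b (bshift a P) = bshift (kcat a b) P.
Proof.
move=> ab; apply/seteqP; split=> c; rewrite /bshift /= ksource_cat //.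
  by move=> [bc [_]]; rewrite -kcatA.
by move=> [bc]; rewrite kcatA // krange_cat.
Qed.

Lemma bshift_source P l : P l -> bshift l P (kid (ksource l)).
Proof. by move=> Pl; split; rewrite ?krange_id ?kcat1r. Qed.

(** Build an increasing sequence of paths, the [j]-th maximal below the constant degree [j] and with
    source outside [H], and take all prefixes. As [H] is hereditary, prefixes avoid it too. *)
Lemma bfilter_exists (H : set (kvert L)) v : hereditary H -> saturated H ->
  ~ H v -> exists P, [/\ bfilter P, P (kid v) & forall a, P a -> ~ H (ksource a)].
Proof.
move=> hH sH Hv; pose N (j : nat) : degree k := [ffun=> j].
have step (jl : nat * kpath L) : exists l', dle (kdeg jl.2) (N jl.1) -> ~ H (ksource jl.2) ->
    [/\ kprefix jl.2 l', Lle (N jl.1) l' & ~ H (ksource l')].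
  case: jl => j l /=; have [Hl|Hl] := pselect (H (ksource l)); first by exists l.
  (* By saturation, not every maximal continuation can end in [H]. *)
  have [c [[lc' cn] Hc]] : exists c, vLle (ksource l) (dsub (N j) (kdeg l)) c /\
      ~ H (ksource c).
    apply: contrapT => hc; apply: Hl; apply: (sH _ (dsub (N j) (kdeg l))) => _ [c cl <-].
    by apply: contrapT => Hc; apply: hc; exists c.
  exists (kcat l c) => lN _; split; first by exists c.
    exact: Lle_cat_sub.
  by rewrite ksource_cat.
have [f hf] := choice step.
pose lam := fix lam j := if j is j'.+1 then f (j'.+1, lam j') else kid v.
have NS j : dle (N j) (N j.+1) by apply/dleP => i; rewrite !ffunE.
have lamP j : Lle (N j) (lam j) /\ ~ H (ksource (lam j)).
  elim: j => [|j [[jN _] Hj]]; last first.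
    by have [] := hf (j.+1, lam j) (dle_trans jN (NS j)) Hj.
  split; last by rewrite ksource_id.
  have -> : N 0%N = kdeg (kid v) by rewrite kdeg_id; apply/ffunP => i; rewrite !ffunE.
  exact: Lle_deg.
have lamS j : kprefix (lam j) (lam j.+1).
  have [[jN _] Hj] := lamP j.
  by have [] := hf (j.+1, lam j) (dle_trans jN (NS j)) Hj.
have lam_mono i j : (i <= j)%N -> kprefix (lam i) (lam j).
  elim: j => [|j IH]; first by rewrite leqn0 => /eqP ->; exact: kprefix_refl.
  rewrite leq_eqVlt => /orP[/eqP ->|/IH ij]; first exact: kprefix_refl.
  exact: kprefix_trans ij (lamS j).
exists [set a | exists j, kprefix a (lam j)]; split.
- split.
  + move=> a b [i ai] [j bj]; exists (lam (maxn i j)); split.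
    * by exists (maxn i j); exact: kprefix_refl.
    * by apply: (kprefix_trans ai); apply: lam_mono; exact: leq_maxl.
    * by apply: (kprefix_trans bj); apply: lam_mono; exact: leq_maxr.
  + by move=> a c [j cj] ac; exists j; exact: kprefix_trans cj.
  + move=> n; pose j := \max_(i < k) n i.
    have nj : dle n (N j) by apply/dleP => i; rewrite ffunE; exact: leq_bigmax.
    have [a aj an] := Lle_kinit lc nj (proj1 (lamP j)).
    by exists a => //; exists j.
- by exists 0%N; exact: kprefix_refl.
- move=> a [j [b ab E]] Ha; have [_] := lamP j; apply.
  by rewrite E ksource_cat //; apply: hH; rewrite -ab.
Qed.

End BoundaryFilters.

(** * The action on functions of boundary paths *)

Section Representation.
Variables (K : fieldType) (k : nat) (L : kgraph k).
Hypothesis lc : locally_convex L.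
Variable X : set (set (kpath L)).
Hypothesis Xfilter : forall P, X P -> bfilter P.
Hypothesis Xshift : forall P l, X P -> P l -> X (bshift l P).
Hypothesis Xcons : forall P l, X P -> P (kid (ksource l)) -> X (bcons l P).
Implicit Types (f g : set (kpath L) -> K) (P : set (kpath L)) (l : kpath L).

(* The action of formal expressions on functions on [X]; only the values on
   [X] are meaningful. *)
Fixpoint rep (u : kpterm K L) f P : K :=
  match u with
  | KPgen l => if `[< P l >] then f (bshift l P) else 0
  | KPghost l => if `[< P (kid (ksource l)) >] then f (bcons l P) else 0
  | KPzero => 0
  | KPopp u => - rep u f P
  | KPadd u w => rep u f P + rep w f P
  | KPscale c u => c * rep u f P
  | KPmul u w => rep u (rep w f) P
  end.

(** Relations hold only at points of [X]; this lets them be applied inside a product. *)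
Lemma rep_ext u f g P : (forall Q, X Q -> f Q = g Q) -> X P ->
  rep u f P = rep u g P.
Proof.
elim: u f g P => [l|l||u IH|u IH w IH'|c u IH|u IH w IH'] f g P fg XP //=.
- by case: asboolP => // Pl; apply: fg; exact: Xshift.
- by case: asboolP => // Pl; apply: fg; exact: Xcons.
- by rewrite (IH f g).
- by rewrite (IH f g) // (IH' f g).
- by rewrite (IH f g).
- by apply: IH => // Q XQ; exact: IH'.
Qed.

Lemma rep_linear u c f g :
  rep u (fun Q => c * f Q + g Q) = (fun P => c * rep u f P + rep u g P).
Proof.
elim: u f g => [l|l||u IH|u IH w IH'|d u IH|u IH w IH'] f g; apply/funext => P /=.
- by case: ifP; rewrite // mulr0 addr0.
- by case: ifP; rewrite // mulr0 addr0.
- by rewrite mulr0 addr0.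
- by rewrite IH opprD mulrN.
- by rewrite IH IH' mulrDr addrACA.
- by rewrite IH mulrDr mulrCA.
- by rewrite IH' IH.
Qed.

Lemma repD u f g :
  rep u (fun Q => f Q + g Q) = (fun P => rep u f P + rep u g P).
Proof.
have := rep_linear u 1 f g; rewrite (_ : (fun Q => 1 * f Q + g Q) = (fun Q => f Q + g Q)).
  by move=> ->; apply/funext => P; rewrite mul1r.
by apply/funext => P; rewrite mul1r.
Qed.

Lemma rep0 u : rep u (fun=> 0) = (fun=> 0).
Proof.
have := repD u (fun=> 0) (fun=> 0).
rewrite (_ : (fun=> 0 + 0) = (fun=> 0)); last by apply/funext => P; rewrite addr0.
move=> E; apply/funext => P; apply: (addrI (rep u (fun=> 0) P)).
by rewrite addr0 [in RHS]E.
Qed.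

Lemma repZ u c f : rep u (fun Q => c * f Q) = (fun P => c * rep u f P).
Proof.
have := rep_linear u c f (fun=> 0); rewrite rep0.
rewrite (_ : (fun Q => c * f Q + 0) = (fun Q => c * f Q)).
  by move=> ->; apply/funext => P; rewrite addr0.
by apply/funext => P; rewrite addr0.
Qed.

Lemma rep_kpsum E f P :
  rep (kpsum K E) f P = \sum_(l <- E) rep (KPmul (KPgen K l) (KPghost K l)) f P.
Proof. by elim: E => [|l E IH]; rewrite ?big_nil ?big_cons //= IH. Qed.

Lemma rep_gen_ghost l f P : X P ->
  rep (KPmul (KPgen K l) (KPghost K l)) f P = if `[< P l >] then f P else 0.
Proof.
move=> XP /=; case: asboolP => // Pl.
case: asboolP => [_|]; last by case; exact: bshift_source.
by rewrite bcons_shift //; exact: Xfilter.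
Qed.

Lemma rep_vert v f P : X P ->
  rep (KPgen K (kid v)) f P = if `[< P (kid v) >] then f P else 0.
Proof.
by move=> XP /=; case: asboolP => // Pv; rewrite bshift_id //; exact: Xfilter.
Qed.

Lemma rep_rel u w f P : kprel u w -> X P -> rep u f P = rep w f P.
Proof.
move=> uw; elim: uw f P => //=; clear u w.
- by move=> u w _ IH f P XP; rewrite IH.
- by move=> u w z _ IH _ IH' f P XP; rewrite IH // IH'.
- by move=> u w _ IH f P XP; rewrite IH.
- by move=> u w u' w' _ IH _ IH' f P XP; rewrite IH // IH'.
- by move=> c u w _ IH f P XP; rewrite IH.
- move=> u w u' w' _ IH _ IH' f P XP; rewrite IH //.
  by apply: rep_ext => // Q XQ; exact: IH'.
- by move=> *; rewrite addrA.
- by move=> *; rewrite addrC.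
- by move=> *; rewrite add0r.
- by move=> *; rewrite addNr.
- by move=> *; rewrite mulrA.
- by move=> *; rewrite mul1r.
- by move=> *; rewrite mulrDr.
- by move=> *; rewrite mulrDl.
- by move=> *; rewrite repD.
- by move=> *; rewrite repZ.
- move=> v f P XP; rewrite ksource_id; case: asboolP => // Pv.
  by have bP := Xfilter XP; rewrite bcons_id // bshift_id.
- move=> v w f P XP; have bP := Xfilter XP; case: asboolP => [Pv|nPv].
    rewrite bshift_id //; case: eqP => [->//|vw] /=.
    case: asboolP => // Pw; case: vw; rewrite (bfilter_id_range bP Pv Pw).
    by rewrite krange_id.
  by case: eqP => //= _; case: asboolP.
- move=> l m e f P XP; have -> : kcomp e = kcat l m by rewrite kcatE.
  rewrite bshift_cat //; case: asboolP => Pl.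
    case: asboolP => [[_ Plm]|nPlm]; case: asboolP => // Plm'.
    by case: nPlm.
  case: asboolP => // Plm; case: Pl.
  by apply: (bfilter_prefix (Xfilter XP) Plm); exists m.
- move=> l m e f P XP; have -> : kcomp e = kcat l m by rewrite kcatE.
  have bP := Xfilter XP; rewrite ksource_cat //; case: asboolP => // Pm.
  rewrite bcons_cat //; case: asboolP => // -[].
  by rewrite e; apply: bfilter_id; [exact: bfilter_cons | exact: bcons_self].
(* (KP3): if [m] is an initial segment of [l P], then [l] and [m] have a common extension and must
   be equal. *)
- move=> n l m ln mn f P XP; have bP := Xfilter XP.
  case: eqP => [<-|lm] /=; last first.
    case: asboolP => // Pl; case: asboolP => // Pm; case: lm.
    have [c [_ lc' mc]] := bfilter_join (bfilter_cons lc bP Pl) (bcons_self bP Pl) Pm.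
    exact: Lle_prefix_eq ln mn lc' mc.
  case: asboolP => // Pl; rewrite (bshift_cons bP Pl) bshift_id //.
  by case: asboolP => // -[]; exact: bcons_self.
(* (KP4): a boundary path from [v] has exactly one initial segment in [E], so one summand
   survives. *)
- move=> v n E uE EP f P XP; have bP := Xfilter XP.
  rewrite -/(rep (KPgen K (kid v)) f P) rep_vert // rep_kpsum.
  rewrite (eq_bigr _ (fun l _ => rep_gen_ghost l f XP)).
  case: asboolP => Pv; last first.
    rewrite big1_seq // => l /andP[_ /EP[lv _]]; case: asboolP => // Pl; case: Pv.
    by rewrite -lv; exact: bfilter_id.
  have [a Pa an] := bfilter_Lle bP n.
  have aE : a \in E by apply/EP; split=> //; rewrite -(bfilter_id_range bP Pv Pa).
  rewrite (bigD1_seq a) //= asboolT // big1_seq ?addr0 // => l /andP[la /EP[_ ln]].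
  case: asboolP => // Pl; case/eqP: la.
  have [c [_ lc' ac]] := bfilter_join bP Pl Pa.
  exact: Lle_prefix_eq ln an lc' ac.
Qed.

Definition KPact (x : KP K L) f P : K := rep (repr x) f P.

Lemma KPactE u f P : X P -> KPact (kpcl u) f P = rep u f P.
Proof. by move=> XP; apply: rep_rel => //; exact: kprel_repr. Qed.

Lemma KPact_ext x f g P : (forall Q, X Q -> f Q = g Q) -> X P ->
  KPact x f P = KPact x g P.
Proof. exact: rep_ext. Qed.

Lemma KPactZ x c f : KPact x (fun Q => c * f Q) = (fun P => c * KPact x f P).
Proof. exact: repZ. Qed.

Lemma KPact_add x y f P : X P -> KPact (x + y) f P = KPact x f P + KPact y f P.
Proof.
move=> XP; have [u <-] := kpcl_surj x; have [w <-] := kpcl_surj y.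
by rewrite -kpcl_add !KPactE.
Qed.

Lemma KPact_scale c x f P : X P -> KPact (c *: x) f P = c * KPact x f P.
Proof.
by move=> XP; have [u <-] := kpcl_surj x; rewrite -kpcl_scale !KPactE.
Qed.

Lemma KPact_mul x y f P : X P -> KPact (x ** y) f P = KPact x (KPact y f) P.
Proof.
move=> XP; have [u <-] := kpcl_surj x; have [w <-] := kpcl_surj y.
rewrite -kpcl_mul !KPactE //=; apply: rep_ext => // Q XQ.
by rewrite KPactE.
Qed.

Lemma KPact0 f P : X P -> KPact 0 f P = 0.
Proof. by move=> XP; rewrite (@KPactE (KPzero K L)). Qed.

Lemma KPact_vert v f P : X P ->
  KPact (kps K (kid v)) f P = if `[< P (kid v) >] then f P else 0.
Proof. by move=> XP; rewrite /kps KPactE ?rep_vert. Qed.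

Lemma KPact_proj l f P : X P ->
  KPact (kps K l ** kpt K l) f P = if `[< P l >] then f P else 0.
Proof. by move=> XP; rewrite -kpcl_mul KPactE ?rep_gen_ghost. Qed.

End Representation.

(** * Purely infinite Kumjian-Pask algebras *)


Section TailOrbit.
Variables (k : nat) (L : kgraph k).
Hypothesis lc : locally_convex L.
Variable P0 : set (kpath L).
Hypothesis bP0 : bfilter P0.
Implicit Types (a b c d l : kpath L) (Q : set (kpath L)).

Definition tail_orbit : set (set (kpath L)) := [set Q | bfilter Q /\
  exists a b, [/\ Q a, P0 b, ksource a = ksource b & bshift a Q = bshift b P0]].

Lemma tail_orbit_filter Q : tail_orbit Q -> bfilter Q.
Proof. by case. Qed.

Lemma tail_orbit_self : tail_orbit P0.
Proof. by split=> //; have [a Pa _] := bfilter_Lle bP0 0; exists a, a. Qed.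

(** Follow the common tail until the segment of [Q] passes [l], then remove [l] from it. *)
Lemma tail_orbit_shift Q l : tail_orbit Q -> Q l -> tail_orbit (bshift l Q).
Proof.
move=> [bQ [a [b [Qa Pb ab E]]]] Ql; split; first exact: bfilter_shift.
have [c [ac Qac [d ld cE]]] := bfilter_join_cat bQ Qa Ql.
have [bc Pbc] : bshift b P0 c by rewrite -E; split.
exists d, (kcat b c); split=> //.
- by split=> //; rewrite -cE.
- by have := congr1 ksource cE; rewrite !ksource_cat.
- by rewrite bshift_cat // -cE -(bshift_cat _ ac) E bshift_cat.
Qed.

Lemma tail_orbit_cons Q l : tail_orbit Q -> Q (kid (ksource l)) ->
  tail_orbit (bcons l Q).
Proof.
move=> [bQ [a [b [Qa Pb ab E]]]] Ql; split; first exact: bfilter_cons.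
have [la Ca] := bcons_mem bQ Ql Qa.
exists (kcat l a), b; split=> //; first by rewrite ksource_cat.
by rewrite -bshift_cat // bshift_cons.
Qed.

(** Follow the common tail past both [c] and [d]: first far enough along [Q], then far enough along
    [P0]. *)
Lemma tail_orbit_join Q c d : tail_orbit Q -> Q c -> P0 d -> exists e f,
  [/\ ksource c = krange e, ksource d = krange f, P0 (kcat d f) &
    ksource e = ksource f].
Proof.
move=> [bQ [a [b [Qa Pb ab E]]]] Qc Pd.
have [g [ag Qag [h ch gE]]] := bfilter_join_cat bQ Qa Qc.
have [bg Pbg] : bshift b P0 g by rewrite -E; split.
have [j [bgj Pj [f df jE]]] := bfilter_join_cat bP0 Pbg Pd.
have gj : ksource g = krange j by rewrite -bgj ksource_cat.
have hj : ksource h = krange j.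
  by have := congr1 ksource gE; rewrite -gj !ksource_cat.
exists (kcat h j), f; split=> //; first by rewrite krange_cat.
  by rewrite -jE.
by have := congr1 ksource jE; rewrite !ksource_cat.
Qed.

End TailOrbit.

(** * Vertex projections *)

Section Vertices.
Variables (K : fieldType) (k : nat) (L : kgraph k).
Hypothesis lc : locally_convex L.
Hypothesis rf : row_finite L.
Implicit Types (a b e f : kpath L) (v w : kvert L).

Local Notation s l := (kps K l).
Local Notation t l := (kpt K l).
Local Notation sv v := (kps K (kid v)).

(** At a boundary path from [v], the projection preserves the value of the constant function [1];
    here [X] consists of all boundary paths. *)
Lemma kps_vert_neq0 v : sv v <> 0.
Proof.
move=> v0; have h0 : hereditary (set0 : set (kvert L)) by [].
have [P [bP Pv _]] := bfilter_exists (v := v) lc h0 (@saturated0 _ L) id.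
have shift (Q : set (kpath L)) l : bfilter Q -> Q l -> bfilter (bshift l Q).
  by move=> ?; exact: bfilter_shift.
have cons (Q : set (kpath L)) l : bfilter Q -> Q (kid (ksource l)) ->
    bfilter (bcons l Q) by move=> ?; exact: bfilter_cons.
have bb (Q : set (kpath L)) : bfilter Q -> bfilter Q by [].
have := KPact_vert lc bb shift cons v (fun=> 1 : K) bP.
rewrite v0 (KPact0 lc bb shift cons) // asboolT // => /eqP.
by rewrite eq_sym oner_eq0.
Qed.

(** By (KP3) the paths [ae] and [bf] give orthogonal copies of their common source projection below
    [sv v]. *)
Lemma absorbs_two_paths n v a b e f : purely_infinite (KP K L) ->
    Lle n a -> Lle n b -> a <> b -> krange a = v -> krange b = v ->
    ksource a = krange e -> ksource b = krange f -> ksource e = ksource f ->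
  absorbs (sv v) (sv (ksource e)).
Proof.
move=> pi an bn ab av bv ae bf ef.
have ortho (c d g h : kpath L) : Lle n c -> Lle n d -> c <> d ->
    krange d = v -> ksource c = krange g -> ksource d = krange h ->
    t (kcat c g) ** sv v ** s (kcat d h) = 0.
  move=> cn dn /eqP cd dv cg dh.
  rewrite -nmulA (@kps_range _ _ _ v) ?krange_cat //.
  rewrite -kptM // -kpsM // nmulA -(nmulA (t g)) (kpt_kps _ cn dn).
  by rewrite (negbTE cd) nmul0r nmul0l.
have same (c g : kpath L) : krange c = v -> ksource c = krange g ->
    t (kcat c g) ** sv v ** s (kcat c g) = sv (ksource g).
  by move=> cv cg; rewrite kpt_range ?krange_cat // kpt_kps_same ksource_cat.
apply: (@absorbs_two_copies _ _ _ (t (kcat a e)) (t (kcat b f))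
  (s (kcat a e)) (s (kcat b f)) (@KP_s_unital K k L) pi (kps_idem K _)).
- exact: same.
- exact: ortho.
- by apply: ortho => // ba; apply: ab.
- by rewrite ef; exact: same.
Qed.

Lemma absorbs_vertex v : purely_infinite (KP K L) -> absorbs (sv v) (sv v).
Proof.
move=> pi; apply: contrapT => nv.
have idI := absorbs_ideal (@KP_s_unital K k L) (sv v).
have [P0 [bP0 Pv PH]] :=
  bfilter_exists lc (ivert_hereditary idI) (ivert_saturated rf idI) nv.
pose X := tail_orbit P0; pose XP0 : X P0 := tail_orbit_self bP0.
have XB := @tail_orbit_filter _ _ P0.
have Xs := @tail_orbit_shift _ _ P0.
have Xc := @tail_orbit_cons _ _ lc P0.
have uniqX Q : X Q -> Q (kid v) -> Q = P0.
  move=> XQ Qv; have bQ := XB _ XQ.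
  (* If [a] and [b] differed, prolonging them to a common source on [P0] would give two orthogonal
     copies below [sv v], forcing that source into the hereditary set that [P0] avoids. *)
  have same n a b : Q a -> P0 b -> Lle n a -> Lle n b -> a = b.
    move=> Qa Pb an bn; apply: contrapT => ab.
    have [e [f [ae bf Pbf ef]]] := tail_orbit_join bP0 XQ Qa Pb.
    apply: (PH _ Pbf); rewrite ksource_cat // -ef.
    apply: absorbs_two_paths pi an bn ab _ _ ae bf ef.
      exact/esym/(bfilter_id_range bQ).
    exact/esym/(bfilter_id_range bP0).
  apply/seteqP; split=> a ha.
    have [b Pb bn] := bfilter_Lle bP0 (kdeg a).
    by rewrite (same _ a b ha Pb (Lle_deg a) bn).
  have [b Qb bn] := bfilter_Lle bQ (kdeg a).
  by rewrite -(same _ b a Qb ha bn (Lle_deg a)).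
have [[Q [XQ nQv]]|allv] := pselect (exists Q, X Q /\ ~ Q (kid v)); last first.
  (* The orbit is a single point, so every element acts by a scalar and [c] is a character. *)
  pose c (x : KP K L) := KPact x (fun=> 1) P0.
  have XE Q : X Q -> Q = P0.
    move=> XQ; apply: uniqX => //; apply: contrapT => Qv.
    by apply: allv; exists Q.
  apply: (@char_not_purely_infinite K (KP K L) c _ _ _ (sv v)) pi.
  - by move=> x y; exact: (KPact_add lc XB Xs Xc).
  - move=> x y; rewrite {1}/c (KPact_mul lc XB Xs Xc) //.
    transitivity (KPact x (fun=> c y * 1) P0).
      by apply: (KPact_ext Xs Xc) => // Q /XE ->; rewrite mulr1.
    by rewrite KPactZ mulrC.
  - by move=> a x; exact: (KPact_scale lc XB Xs Xc).
  - by rewrite /c (KPact_vert lc XB Xs Xc) // asboolT.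
have [bQ [a [b [Qa Pb ab _]]]] := XQ.
have bv : krange b = v by exact/esym/(bfilter_id_range bP0).
(* The second summand is in the ideal because [s_a t_a = (s_a t_b) s_v (s_b t_a)]. *)
have /(proj2 pi)/precsim1P[x [y xyE]] :
    in_RaR (sv v) (sv v + s a ** t a).
  exists 2%N, (fun i => if i == ord0 then sv v else s a ** t b),
    (fun i => if i == ord0 then sv v else s b ** t a).
  rewrite big_ord_recl big_ord1 /= !kps_idem; congr (_ + _).
  rewrite -(nmulA (s a)) kpt_range // -nmulA (nmulA (t b)) kpt_kps_same.
  by rewrite kpt_source.
pose dirac P : set (kpath L) -> K := fun R => if `[< R = P >] then 1 else 0.
(* On [X] the projection [sv v] sends [f] to its value at [P0] times the point mass there, so
   [x ** sv v ** y] has rank at most one. *)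
have xyP (f : set (kpath L) -> K) P : X P -> KPact (sv v + s a ** t a) f P =
    KPact y f P0 * KPact x (dirac P0) P.
  move=> XP; rewrite xyE !(KPact_mul lc XB Xs Xc) //.
  transitivity (KPact x (fun R => KPact y f P0 * dirac P0 R) P); last first.
    by rewrite KPactZ.
  apply: (KPact_ext Xs Xc) => // R XR.
  rewrite (KPact_vert lc XB Xs Xc) // /dirac; case: asboolP => Rv.
    by rewrite (uniqX _ XR Rv) asboolT // mulr1.
  by rewrite asboolF ?mulr0 // => RP; apply: Rv; rewrite RP.
have QP0 : Q <> P0 by move=> E; apply: nQv; rewrite E.
have P0a : ~ P0 a.
  move=> Pa; apply: nQv; rewrite (bfilter_id_range bP0 Pv Pa).
  exact: bfilter_id Qa.
have actE (f : set (kpath L) -> K) P : X P -> KPact (sv v + s a ** t a) f P =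
    (if `[< P (kid v) >] then f P else 0) + (if `[< P a >] then f P else 0).
  move=> XP; rewrite (KPact_add lc XB Xs Xc) // (KPact_vert lc XB Xs Xc) //.
  by rewrite (KPact_proj lc XB Xs Xc).
(* At [P0] and [Q] the diagonal entries are [1] and the entry at [Q] against [P0] is [0], which no
   product of a column and a row allows. *)
have := xyP (dirac P0) _ XP0; have := xyP (dirac P0) _ XQ; have := xyP (dirac Q) _ XQ.
rewrite !actE // /dirac (asboolF nQv) (asboolT Qa) (asboolT Pv) (asboolF P0a).
rewrite (asboolF QP0) !asboolT // !add0r addr0.
set g := KPact x _ Q; set c1 := KPact y _ P0; set c2 := KPact y _ P0.
move=> E1 /esym/eqP E2 E3; move: E2; rewrite mulf_eq0 => /orP[]/eqP E2.
  by move: E3; rewrite E2 mul0r => /eqP; rewrite oner_eq0.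
by move: E1; rewrite E2 mulr0 => /eqP; rewrite oner_eq0.
Qed.

End Vertices.

Theorem theorem4p2 (k : nat) (hk : (1 <= k)%N) (L : kgraph k)
    (hlc : locally_convex L) (hrf : row_finite L) (K : fieldType)
    (hsa : strongly_aperiodic L) :
  (purely_infinite (KP K L) <-> properly_purely_infinite (KP K L)) /\
  (properly_purely_infinite (KP K L) <->
     forall v : kvert L, nu_idempotent (kps K (kid v)) /\
       properly_infinite (kps K (kid v))).
Proof.
have vert_ppi : (forall v, properly_infinite (kps K (kid v))) ->
  properly_purely_infinite (KP K L) := @properly_infinite_vertices K k L hrf hsa.
split; split.
- move=> pi; apply: vert_ppi => v; apply/properly_infiniteP.
  by split; [exact: kps_vert_neq0 | exact: absorbs_vertex].
- exact: ppi_purely_infinite.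
- move=> ppi v; split; first exact: kps_idem.
  by apply: ppi; exact: kps_vert_neq0.
- by move=> h; apply: vert_ppi => v; have [] := h v.
Qed.
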